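(* Let $\mathbb{O}$ be the split octonion algebra over $\mathbb{F}_2$. The automorphism group $\mathrm{G}_2(2)=\operatorname{Aut}(\mathbb{O})$ is isomorphic to the group $\mathrm{P\Gamma U}(3,\mathbb{F}_9|\mathbb{F}_3)$. In fact, the action of $\operatorname{Aut}(\mathbb{O})$ on the set $\mathcal{D}$ of subalgebras of $\mathbb{O}$ isomorphic to $\mathbb{F}_4$ is equivalent to the doubly transitive action of $\mathrm{P\Gamma U}(3,\mathbb{F}_9|\mathbb{F}_3)$ on the set of points of the Hermitian unital of order $3$.
   Context: Octonion algebra. Let $\mathbb{H}=\mathbb{F}^{2\times2}$ over $\mathbb{F}=\mathbb{F}_2$, with norm $N=\det$ and standard involution $\bar a=\operatorname{tr}(a)\mathbf 1-a$. The split octonion algebra over $\mathbb{F}$ is $\mathbb{O}=\mathbb{H}\oplus\mathbb{H}w$ with multiplication $(a+xw)(b+yw)=ab+\bar y x+(ya+x\bar b)w$ for $a,b,x,y\in\mathbb{H}$. $\operatorname{Aut}(\mathbb{O})$ is the group of all algebra automorphisms of $\mathbb{O}$. Unitary group. Let $h$ be a non-degenerate Hermitian form on $\mathbb{F}_9^3$ with respect to the generator of $\operatorname{Gal}(\mathbb{F}_9|\mathbb{F}_3)$ (essentially unique). $\Gamma\mathrm{U}(3,\mathbb{F}_9|\mathbb{F}_3)$ is the group of all semi-similitudes of $h$, i.e. of all bijective semilinear maps $\varphi$ (with companion field automorphism $\sigma$) such that $h(\varphi(x),\varphi(y))=\lambda\,\sigma(h(x,y))$ for all $x,y$, for some scalar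 $\lambda\ne0$ depending on $\varphi$. $\mathrm{P\Gamma U}(3,\mathbb{F}_9|\mathbb{F}_3)$ is the group induced by it on the projective plane $\mathrm{PG}(2,\mathbb{F}_9)$. The points of the Hermitian unital of order $3$ are the $1$-dimensional subspaces $P$ of $\mathbb{F}_9^3$ with $h|_P=0$. Two group actions $(G,\Omega)$ and $(G',\Omega')$ are equivalent if there are a group isomorphism $G\to G'$ and a bijection $\Omega\to\Omega'$ intertwining the actions. *)

(* Defs.v *)
From HB Require Import structures.
From mathcomp Require Import all_boot all_order all_algebra all_fingroup.
From mathcomp Require Import all_solvable all_field sesquilinear boolp.

Set Implicit Arguments.
Unset Strict Implicit.
Unset Printing Implicit Defensive.

Import GRing.Theory.
Local Open Scope ring_scope.

(* The pair (a, x) stands for a + x w.  Multiplication is oct_mul below, not   *)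
(* the componentwise ring product of the underlying pair.                      *)
Definition octonion (F : fieldType) : predArgType := ('M[F]_2 * 'M[F]_2)%type.

HB.instance Definition _ (F : fieldType) := GRing.Lmodule.on (octonion F).
HB.instance Definition _ (F : finFieldType) := Finite.on (octonion F).

Definition quat_conj (F : fieldType) (a : 'M[F]_2) : 'M[F]_2 := (\tr a)%:M - a.

Definition oct_mul (F : fieldType) (u v : octonion F) : octonion F :=
  (u.1 *m v.1 + quat_conj v.2 *m u.2, v.2 *m u.1 + u.2 *m quat_conj v.1).

Section OctonionAutomorphisms.
Variable F : finFieldType.

Definition oct_aut : {set {perm octonion F}} :=
  [set s : {perm octonion F} | `[< linear s /\ {morph s : u v / oct_mul u v} >]].

Fact oct_aut_group_set : group_set oct_aut.
Proof.
apply/group_setP; split=> [|s t]; rewrite !inE.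
  by apply/asboolP; split=> [a u v | u v]; rewrite !perm1.
move=> /asboolP[sL sM] /asboolP[tL tM]; apply/asboolP.
by split=> [a u v | u v]; rewrite !permM ?sL ?tL // sM tM.
Qed.
Canonical oct_aut_group := Group oct_aut_group_set.

Definition subalgebra (A : {set octonion F}) : Prop :=
  submod_closed A /\ {in A &, forall u v, oct_mul u v \in A}.

Definition algebra_iso (K : lalgType F) (A : {set octonion F}) : Prop :=
  exists f : {linear K -> octonion F},
    [/\ injective f, {morph f : x y / x * y >-> oct_mul x y}
      & forall u, u \in A <-> exists x, f x = u].

Definition subalgebras_iso (K : lalgType F) : {set {set octonion F}} :=
  [set A | `[< subalgebra A /\ algebra_iso K A >]].

End OctonionAutomorphisms.

HB.instance Definition _ (F : finFieldType) (vT : vectType F) :=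
  Countable.copy {vspace vT}
    (can_type (@VectorInternalTheory.vs2mxK F vT)).
HB.instance Definition _ (F : finFieldType) (vT : vectType F) :=
  isFinite.Build {vspace vT}
    (pcan_enumP (can_pcan (@VectorInternalTheory.vs2mxK F vT))).

Section Unitary.
Variable F : finFieldType.

Definition pg_point : predArgType :=
  {P : {vspace 'rV[F]_3} | \dim P == 1}.
HB.instance Definition _ := Finite.on pg_point.

Variable h : 'rV[F]_3 -> 'rV[F]_3 -> F.

(* A ring endomorphism of the finite field F is a field automorphism.          *)
Definition semisimilitude (phi : 'rV[F]_3 -> 'rV[F]_3) : Prop :=
  exists sigma : {rmorphism F -> F},
    linear_for (sigma \; *:%R) phi /\
    exists2 lambda : F, lambda != 0
      & forall x y, h (phi x) (phi y) = lambda * sigma (h x y).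

Definition GammaU : {set {perm 'rV[F]_3}} :=
  [set phi : {perm 'rV[F]_3} | `[< semisimilitude phi >]].

(* The second condition says that s maps each point P to its image phi(P).     *)
Definition PGammaU : {set {perm pg_point}} :=
  [set s : {perm pg_point} | `[< exists2 phi, phi \in GammaU
     & forall (P : pg_point) x, (phi x \in val (s P)) = (x \in val P) >]].

Definition unital_points : {set pg_point} :=
  [set P : pg_point | `[< {in val P &, forall x y, h x y = 0} >]].

Fact GammaU_group_set : group_set GammaU.
Proof.
apply/group_setP; split=> [|s t]; rewrite !inE.
  apply/asboolP; exists idfun; split=> [a u v|]; first by rewrite !perm1.
  by exists 1; rewrite ?oner_neq0 // => x y; rewrite !perm1 mul1r.
move=> /asboolP[f [sL [c c0 sh]]] /asboolP[g [tL [d d0 th]]]; apply/asboolP.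
exists (g \o f); split=> [a u v|]; first by rewrite !permM sL tL.
exists (d * g c); first by rewrite mulf_neq0 ?fmorph_eq0.
by move=> x y; rewrite !permM th sh rmorphM mulrA.
Qed.
Canonical GammaU_group := Group GammaU_group_set.

Fact PGammaU_group_set : group_set PGammaU.
Proof.
apply/group_setP; split=> [|s t]; rewrite !inE.
  by apply/asboolP; exists 1%g; rewrite ?group1 // => P x; rewrite !perm1.
move=> /asboolP[f fG fs] /asboolP[g gG gt]; apply/asboolP.
by exists (f * g)%g; [exact: groupM | move=> P x; rewrite !permM gt fs].
Qed.
Canonical PGammaU_group := Group PGammaU_group_set.

End Unitary.

Definition equivalent_actions (aT aT' : finGroupType)
    (D : {set aT}) (D' : {set aT'}) (rT rT' : finType)
    (to : action D rT) (to' : action D' rT')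
    (G : {group aT}) (S : {set rT}) (G' : {group aT'}) (S' : {set rT'}) : Prop :=
  [/\ [acts G, on S | to], [acts G', on S' | to']
    & exists (f : {morphism G >-> aT'}) (beta : rT -> rT'),
        [/\ isom G G' f, {in S &, injective beta}, beta @: S = S'
          & {in S & G, morph_act to to' beta f}]].

(* Main.v *)
Require Import Defs.
From HB Require Import structures.
From mathcomp Require Import all_boot all_order all_algebra all_fingroup.
From mathcomp Require Import all_solvable all_field sesquilinear boolp.
From mathcomp Require Import ring.

Set Implicit Arguments.
Unset Strict Implicit.
Unset Printing Implicit Defensive.

(******************************************************************************)
(* There are 28 subalgebras isomorphic to F_4 and 28 points on the unital.    *)
(* With both sets numbered suitably, four explicit octonion automorphisms and *)
(* four explicit semisimilitudes (a torus element d, the Frobenius map f, a   *)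
(* translation t and a Weyl element w) induce the same four permutations of   *)
(* {0, ..., 27}, which generate a doubly transitive group H.  In either group *)
(* an element fixing the points 0 and 1 is one of the 16 products d^i f^j:    *)
(* for the semisimilitudes because it is diagonal in a hyperbolic basis, for  *)
(* the octonions because two of the subalgebras and one more element generate *)
(* the whole algebra and satisfy relations with 16 solutions.  Hence both     *)
(* groups act faithfully on the 28 points with image H.                       *)
(******************************************************************************)

Import GRing.Theory.

(** * Actions on an indexed set *)

(** The two groups are compared inside the symmetric group on 28 letters. Once the points of an
    action are numbered, the action is a homomorphism into that group. If both homomorphisms are
    injective with the same image, one followed by the inverse of the other is a group isomorphism,
    and matching points of equal number intertwines the actions ([equivalent_actions_common_image]).

    The image is found from a two-point stabilizer ([injm_two_point_stabilizer]). Let H be generated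
    by the permutations of d, f, t, w. Orbit computations show that H is transitive and that the
    stabilizer of 0 in H is transitive on the other points. So every element of the full image
    becomes, after correction by H, one that fixes 0 and 1. If the group elements fixing 0 and 1 are
    all words d^i f^j with i < 8 and j < 2, the image is H. The kernel is then trivial, because only
    the empty word acts trivially. By [tables_image] it remains, for each group, to list its points,
    to exhibit four elements acting by the tables, and to bound the two-point stabilizer by these 16
    words.

    Among octonions, the copies of F_4 are the sets {0, 1, c, c + 1} with c^2 = c + 1
    ([subalgebras_iso_F4]). An automorphism is determined by its values on [cgen 0], [cgen 1] and
    [bits 64]. If it fixes the first two subalgebras there are 2 * 2 * 256 candidate triples of
    values, and two relations leave only 16 ([two_generator_stabilizer]).

    In a hyperbolic basis ([hyperbolic_basis_ex]) the Hermitian form is x z'^3 + y y'^3 + z x'^3. A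
    semisimilitude fixing the points of e0 and e2 also preserves the line of e1, which is orthogonal
    to both. Up to a scalar it is a field automorphism followed by diag(A, 1, D) with A D^3 = 1:
    eight choices of A and two field automorphisms ([two_point_stabilizer]). *)

Section IndexedAction.
Local Open Scope group_scope.
Variables (aT : finGroupType) (D : {set aT}) (rT T : finType).
Variables (to : action D rT) (G : {group aT}) (k0 : T) (p : T -> rT).
Hypotheses (p_inj : injective p) (actsG : [acts G, on p @: setT | to]).

Definition index_of (x : rT) : T := odflt k0 [pick k | p k == x].

Lemma index_ofK : cancel p index_of.
Proof.
move=> k; rewrite /index_of; case: pickP => [l /eqP/p_inj // | /(_ k)].
by rewrite eqxx.
Qed.

Lemma ofK_index : {in p @: setT, cancel index_of p}.
Proof. by move=> _ /imsetP[k _ ->]; rewrite index_ofK. Qed.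

Lemma act_index k g : g \in G -> p (index_of (to (p k) g)) = to (p k) g.
Proof.
by move=> Gg; rewrite ofK_index // (acts_act actsG) // imset_f.
Qed.

(** An action must be injective at every [g], also outside its domain; the identity is the default
    there. *)
Definition index_fun (k : T) (g : aT) : T :=
  if g \in G then index_of (to (p k) g) else k.

Fact index_fun_is_action : is_action G index_fun.
Proof.
split=> [g k l | k g h Gg Gh]; rewrite /index_fun.
  case: ifP => // Gg /(congr1 p); rewrite !act_index //.
  by move/(act_inj to)/p_inj.
have sGD := acts_dom actsG.
by rewrite groupM // Gg Gh act_index // actMin ?(subsetP sGD).
Qed.

Definition index_action := Action index_fun_is_action.
Definition index_perm : {morphism G >-> {perm T}} :=
  actperm_morphism index_action.

Lemma index_permE g k : g \in G -> p (index_perm g k) = to (p k) g.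
Proof.
by move=> Gg; rewrite /= actpermE /= /index_fun Gg act_index.
Qed.

Lemma index_permP g k l :
  g \in G -> to (p k) g = p l -> index_perm g k = l.
Proof. by move=> Gg e; apply: p_inj; rewrite index_permE. Qed.

End IndexedAction.

(** * Comparison of actions through their images in a symmetric group *)

Section CommonImage.
Local Open Scope group_scope.

Lemma equivalent_actions_common_image (aT aT' : finGroupType)
    (D : {set aT}) (D' : {set aT'}) (rT rT' T : finType)
    (to : action D rT) (to' : action D' rT')
    (G : {group aT}) (G' : {group aT'}) (k0 : T)
    (p : T -> rT) (p' : T -> rT')
    (p_inj : injective p) (p'_inj : injective p')
    (actsG : [acts G, on p @: setT | to])
    (actsG' : [acts G', on p' @: setT | to'])
    (r := index_perm k0 p_inj actsG) (r' := index_perm k0 p'_inj actsG') :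
  'injm r -> 'injm r' -> r @* G = r' @* G' ->
  equivalent_actions to to' G (p @: setT) G' (p' @: setT).
Proof.
move=> injr injr' eqim; split=> //.
have sub : G \subset 'dom (invm injr' \o r).
  by rewrite -sub_morphim_pre //= eqim.
pose f : {morphism G >-> aT'} := restrm_morphism sub (invm injr' \o r).
have fE g : g \in G -> f g \in G' /\ r' (f g) = r g.
  move=> Gg.
  have r'g : r g \in r' @* G' by rewrite -eqim mem_morphim.
  by split; [case/morphimP: r'g => x _ Gx e; rewrite /= /restrm /= e invmE
           | rewrite /= /restrm /= invmK].
exists f, (p' \o index_of k0 p); split.
- apply/isomP; split.
    apply/injmP=> x y Gx Gy e.
    by apply: (injmP injr) => //; rewrite -(proj2 (fE x Gx)) e (proj2 (fE y Gy)).
  apply/setP=> y; apply/morphimP/idP => [[x _ Gx ->]|Gy]; first exact: (fE x Gx).1.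
  have: r' y \in r @* G by rewrite eqim mem_morphim.
  case/morphimP=> x _ Gx e; exists x => //.
  by apply: (injmP injr'); rewrite ?(fE x Gx).1 // (fE x Gx).2.
- move=> x y Sx Sy /p'_inj e.
  by rewrite -(ofK_index k0 p_inj Sx) e (ofK_index k0 p_inj Sy).
- apply/setP=> y; apply/imsetP/imsetP.
    by case=> x _ ->; exists (index_of k0 p x).
  by case=> k _ ->; exists (p k); rewrite ?imset_f //= index_ofK.
move=> x g Sx Gg /=; have [G'fg rfg] := fE g Gg.
case/imsetP: Sx => k _ ->; rewrite index_ofK //.
rewrite -(index_permE k0 p_inj actsG) // index_ofK //.
by rewrite -/r -rfg /r' index_permE.
Qed.

(* Doubly transitive correction by <<A>> moves any element of G into the      *)
(* stabilizer of k0 and k1, which consists of the words d^i f^j.              *)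
Lemma injm_two_point_stabilizer (aT : finGroupType) (T : finType)
    (G : {group aT}) (r : {morphism G >-> {perm T}}) (A : {set aT})
    (k0 k1 : T) (d f : aT) (m n : nat) :
    A \subset G -> d \in A -> f \in A ->
    (forall k, exists2 s, s \in r @* <<A>> & s k0 = k) ->
    (forall k, k != k0 ->
       exists2 s, s \in r @* <<A>> & s k0 = k0 /\ s k1 = k) ->
    k1 != k0 ->
    (forall g, g \in G -> r g k0 = k0 -> r g k1 = k1 ->
       exists i j, [/\ i < m, j < n & g = d ^+ i * f ^+ j]) ->
    (forall i j, i < m -> j < n -> r d ^+ i * r f ^+ j = 1 ->
       i = 0%N /\ j = 0%N) ->
  'injm r /\ r @* G = <<r @: A>>.
Proof.
move=> sAG Ad Af tr1 tr2 ne stab triv.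
have [Gd Gf] : d \in G /\ f \in G by split; apply: subsetP sAG _ _.
split.
  apply/subsetP=> g /morphpreP[Gg /set1P rg]; apply/set1P.
  have [||i [j [lti ltj eg]]] := stab g Gg; first by rewrite rg perm1.
    by rewrite rg perm1.
  have [|i0 j0] := triv i j lti ltj; last by rewrite eg i0 j0 mulg1.
  by rewrite -rg eg morphM ?groupX // !morphX.
rewrite -morphimEsub // -morphim_gen //; apply/eqP.
rewrite eqEsubset andbC morphimS ?gen_subG //=.
have sGr : <<A>> \subset G by rewrite gen_subG.
have step s : s \in r @* G -> s k0 = k0 -> s k1 = k1 -> s \in r @* <<A>>.
  case/morphimP=> g _ Gg -> g0 g1.
  have [i [j [_ _ ->]]] := stab g Gg g0 g1.
  by rewrite mem_morphim ?groupM ?groupX // mem_gen.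
have sI : r @* <<A>> \subset r @* G by rewrite morphimS.
apply/subsetP=> s Gs.
(* Here [u] agrees with [s] at [k0], and [v] below fixes [k0] and agrees with [s * u^-1] at [k1]; so
   [s * u^-1 * v^-1] fixes both points. *)
have [u Au u0] := tr1 (s k0).
have [|v Av [v0 v1]] := tr2 ((s * u^-1) k1).
  rewrite permM; apply: contra ne => /eqP e; apply/eqP.
  by apply: (@perm_inj _ s); rewrite -u0 -e permKV.
have: s * u^-1 * v^-1 \in r @* <<A>>.
  apply: step; first by rewrite !groupM // groupV (subsetP sI).
    by rewrite !permM -u0 permK -{1}v0 permK.
  by rewrite !permM in v1 *; rewrite -v1 permK.
by rewrite groupMr ?groupV // groupMr ?groupV.
Qed.

(** To reach a pair (x, y), choose [g] taking [k0] to x, pull y back along [g], and move [k1] there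
    by some [h] fixing [k0]; then [h * g] works. *)
Lemma doubly_transitive_index (aT : finGroupType) (rT T : finType)
    (to : {action aT &-> rT}) (G : {group aT}) (k0 k1 : T)
    (p : T -> rT) (p_inj : injective p)
    (actsG : [acts G, on p @: setT | to])
    (r := index_perm k0 p_inj actsG) :
    (forall k, exists2 s, s \in r @* G & s k0 = k) ->
    (forall k, k != k0 ->
       exists2 s, s \in r @* G & s k0 = k0 /\ s k1 = k) ->
    k1 != k0 ->
  [transitive^2 G, on p @: setT | to].
Proof.
move=> tr1 tr2 ne; apply/imsetP; exists [tuple p k0; p k1].
  rewrite inE /= memtE subset_all /= !imset_f // inE (inj_eq p_inj).
  by rewrite eq_sym ne.
apply/setP=> t; apply/idP/imsetP=> [|[g Gg ->]]; last first.
  apply: n_act_dtuple; first exact: subsetP actsG g Gg.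
  rewrite inE /= memtE subset_all /= !imset_f // inE (inj_eq p_inj).
  by rewrite eq_sym ne.
case/tupleP: t => x t; case/tupleP: t => y t; rewrite {t}(tuple0 t) /=.
rewrite inE /= memtE subset_all /= andbT inE.
case/andP=> nxy /and3P[/imsetP[k _ ex] /imsetP[l _ ey] _].
have [_ /morphimP[g _ Gg ->] gk] := tr1 k.
have [|_ /morphimP[h _ Gh ->] [h0 h1]] := tr2 ((r g)^-1 l).
  apply: contra nxy => /eqP e; rewrite ex ey (inj_eq p_inj) -gk -e.
  by rewrite permKV.
exists (h * g); rewrite ?groupM //; apply: val_inj => /=.
rewrite -(index_permE k0 p_inj actsG) ?groupM // -/r.
rewrite -(index_permE k0 p_inj actsG) ?groupM // -/r.
by rewrite morphM // !permM h0 h1 gk permKV ex ey.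
Qed.

End CommonImage.

(** * Four explicit permutations of 28 points *)

Section PermutationTables.

Definition realizes (s : {perm 'I_28}) (l : seq nat) : Prop :=
  forall k : 'I_28, s k = nth 0%N l k :> nat.

(* Permutations of the points of the unital x z^3 + y^4 + z x^3 = 0 induced   *)
(* by d = diag(1 + i, 1, - (1 + i)), the Frobenius map f, the translation     *)
(* t : (x, y, z) |-> (x - y + z, y + z, z) and the swap w of x and z.  The    *)
(* points are numbered as in unital_list below: 0 is (1 : 0 : 0) and 1 is     *)
(* (0 : 0 : 1).                                                               *)
Definition tab_d : seq nat :=
  [:: 0; 1; 3; 2; 13; 15; 14; 25; 27; 26; 16; 18; 17; 19; 21; 20; 4; 6; 5;
      22; 24; 23; 7; 9; 8; 10; 12; 11]%N.
Definition tab_f : seq nat :=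
  [:: 0; 1; 3; 2; 7; 9; 8; 4; 6; 5; 10; 12; 11; 16; 18; 17; 13; 15; 14;
      19; 21; 20; 25; 27; 26; 22; 24; 23]%N.
Definition tab_t : seq nat :=
  [:: 0; 10; 11; 12; 15; 13; 14; 17; 18; 16; 19; 20; 21; 24; 22; 23; 26;
      27; 25; 1; 2; 3; 6; 4; 5; 8; 9; 7]%N.
Definition tab_w : seq nat :=
  [:: 1; 0; 3; 2; 4; 26; 18; 7; 14; 24; 10; 23; 27; 25; 8; 21; 22; 20; 6;
      19; 17; 15; 16; 11; 9; 13; 5; 12]%N.

Lemma realizes_inj s s' l : realizes s l -> realizes s' l -> s = s'.
Proof. by move=> e e'; apply/permP=> k; apply: val_inj; rewrite /= e e'. Qed.

Lemma realizesX s l n k :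
  realizes s l -> (s ^+ n)%g k = iter n (nth 0%N l) k :> nat.
Proof. by move=> e; elim: n => [|n IHn]; rewrite ?perm1 // expgSr permM e IHn. Qed.

Definition closure_step (ls : seq (seq nat)) (S : seq nat) : seq nat :=
  undup (S ++ flatten [seq map (nth 0%N l) S | l <- ls]).

Lemma closure_ind (ls : seq (seq nat)) (k0 n : nat) (P : nat -> Prop) :
  P k0 -> (forall l k, l \in ls -> P k -> P (nth 0%N l k)) ->
  forall k, k \in iter n (closure_step ls) [:: k0] -> P k.
Proof.
move=> P0 Pl; elim: n => [k|n IHn k]; first by rewrite inE => /eqP->.
rewrite mem_undup mem_cat => /orP[/IHn // | /flatten_mapP[l lls]].
by case/mapP=> j /IHn Pj ->; apply: Pl.
Qed.

Lemma mem_tables (k : 'I_28) :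
  (k : nat) \in iter 9 (closure_step [:: tab_t; tab_d; tab_w]) [:: 0%N].
Proof.
have /allP -> // : all [in iter 9 (closure_step [:: tab_t; tab_d; tab_w])
                              [:: 0%N]] (iota 0 28) by vm_compute.
by rewrite mem_iota add0n ltn_ord.
Qed.

(** Both t and d fix 0, so this computes an orbit of the stabilizer of 0. *)
Lemma mem_tables0 (k : 'I_28) : (0 < k)%N ->
  (k : nat) \in iter 9 (closure_step [:: tab_t; tab_d]) [:: 1%N].
Proof.
move=> k_gt0; have /allP -> // :
    all [in iter 9 (closure_step [:: tab_t; tab_d]) [:: 1%N]] (iota 1 27).
  by vm_compute.
by rewrite mem_iota k_gt0 ltn_ord.
Qed.

Local Open Scope group_scope.

Lemma tables_transitive (H : {group {perm 'I_28}}) (d t w : {perm 'I_28}) :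
  realizes d tab_d -> realizes t tab_t -> realizes w tab_w ->
  d \in H -> t \in H -> w \in H ->
  (forall k, exists2 s, s \in H & s 0%R = k) /\
  (forall k, k != 0%R -> exists2 s, s \in H & s 0%R = 0%R /\ s 1%R = k).
Proof.
move=> ed et ew Hd Ht Hw; split=> k.
  pose P n := exists2 s, s \in H & s 0%R = n :> nat.
  suff [s Hs /val_inj <-] : P k by exists s.
  apply: (@closure_ind [:: tab_t; tab_d; tab_w] 0 9).
  - by exists 1; rewrite ?perm1.
  - move=> l j lP [u Hu <-].
    have [s Hs es] : exists2 s, s \in H & realizes s l.
      by move: lP; rewrite !inE => /or3P[] /eqP->; [exists t | exists d | exists w].
    by exists (u * s); rewrite ?groupM // permM es.
  exact: mem_tables.
move=> nk; pose P n := exists2 s, s \in H & s 0%R = 0%R /\ s 1%R = n :> nat.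
suff [s Hs [s0 /val_inj <-]] : P k by exists s.
apply: (@closure_ind [:: tab_t; tab_d] 1 9).
- by exists 1; rewrite ?perm1.
- move=> l j lP [u Hu [u0 <-]].
  have [s Hs [es s0]] : exists2 s, s \in H & realizes s l /\ s 0%R = 0%R.
    move: lP; rewrite !inE => /orP[] /eqP->; [exists t | exists d] => //;
    by split=> //; apply: val_inj; rewrite /= ?et ?ed.
  by exists (u * s); rewrite ?groupM // !permM u0 s0 es.
by apply: mem_tables0; rewrite ?lt0n.
Qed.

(** The points 4 and 10 lie on one 8-cycle of d, while f fixes 10 and moves 4. Testing the word on
    these two points therefore forces both exponents to vanish. *)
Lemma tables_trivial (d f : {perm 'I_28}) i j :
  realizes d tab_d -> realizes f tab_f -> (i < 8)%N -> (j < 2)%N ->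
  d ^+ i * f ^+ j = 1 -> i = 0%N /\ j = 0%N.
Proof.
move=> ed ef lti ltj /permP e.
have ek k : (k < 28)%N -> iter j (nth 0%N tab_f) (iter i (nth 0%N tab_d) k) = k.
  move=> ltk; have := e (Ordinal ltk); rewrite permM perm1.
  by move/(congr1 val) => /=; rewrite (realizesX _ _ ef) (realizesX _ _ ed).
have := ek 4%N isT; have := ek 10%N isT.
by case: i j lti ltj {ek e} => [|[|[|[|[|[|[|[|i]]]]]]]] [|[|j]].
Qed.

(** The common endgame for both groups; the hypothesis on elements fixing 0 and 1 is where their
    geometry enters. *)
Lemma tables_image (aT : finGroupType) (G : {group aT})
    (r : {morphism G >-> {perm 'I_28}}) (d f t w : aT) :
    d \in G -> f \in G -> t \in G -> w \in G ->
    realizes (r d) tab_d -> realizes (r f) tab_f ->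
    realizes (r t) tab_t -> realizes (r w) tab_w ->
    (forall g, g \in G -> r g 0%R = 0%R -> r g 1%R = 1%R ->
       exists i j, [/\ i < 8, j < 2 & g = d ^+ i * f ^+ j]) ->
  [/\ 'injm r, r @* G = <<[set r d; r f; r t; r w]>>,
      forall k, exists2 s, s \in r @* G & s 0%R = k
    & forall k, k != 0%R ->
        exists2 s, s \in r @* G & s 0%R = 0%R /\ s 1%R = k].
Proof.
move=> Gd Gf Gt Gw ed ef et ew stab.
pose A := [set d; f; t; w].
have sAG : A \subset G by rewrite !subUset !sub1set Gd Gf Gt.
have rA : r @: A = [set r d; r f; r t; r w] by rewrite !imsetU !imset_set1.
have rAG : <<r @: A>> = r @* <<A>> by rewrite -morphimEsub // morphim_gen.
have memA x : x \in [set r d; r f; r t; r w] -> x \in r @* <<A>>.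
  by move=> xA; rewrite -rAG mem_gen // rA.
have [|||tr1 tr2] :=
    @tables_transitive (r @* <<A>>) (r d) (r t) (r w) ed et ew.
- by apply: memA; rewrite !inE eqxx.
- by apply: memA; rewrite !inE eqxx ?orbT.
- by apply: memA; rewrite !inE eqxx ?orbT.
have [injr imr] : 'injm r /\ r @* G = <<r @: A>>.
  apply: (@injm_two_point_stabilizer _ _ _ _ _ 0%R 1%R d f 8 2) => //.
  - by rewrite !inE eqxx.
  - by rewrite !inE eqxx ?orbT.
  by move=> i j lti ltj; apply: tables_trivial.
by split=> //; rewrite imr -?rA // rAG.
Qed.

End PermutationTables.

(** * Octonions over F_2 *)

(** Entries of a 2 x 2 matrix, row by row, as Booleans: statements about all 256 octonions can then
    be decided by evaluation. *)
Definition quat : Type := (bool * bool * bool * bool)%type.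
Definition oct8 : Type := (quat * quat)%type.

Definition qadd (a b : quat) : quat :=
  let: (a0, a1, a2, a3) := a in let: (b0, b1, b2, b3) := b in
  (a0 (+) b0, a1 (+) b1, a2 (+) b2, a3 (+) b3).
Definition qmul (a b : quat) : quat :=
  let: (a0, a1, a2, a3) := a in let: (b0, b1, b2, b3) := b in
  (a0 && b0 (+) a1 && b2, a0 && b1 (+) a1 && b3,
   a2 && b0 (+) a3 && b2, a2 && b1 (+) a3 && b3).
(** The adjugate matrix, whose signs disappear in characteristic 2. *)
Definition qconj (a : quat) : quat :=
  let: (a0, a1, a2, a3) := a in (a3, a1, a2, a0).

Definition oadd (u v : oct8) : oct8 := (qadd u.1 v.1, qadd u.2 v.2).
Definition omul (u v : oct8) : oct8 :=
  (qadd (qmul u.1 v.1) (qmul (qconj v.2) u.2),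
   qadd (qmul v.2 u.1) (qmul u.2 (qconj v.1))).

(* Bit k of n is the k-th of the coordinates a11 a12 a21 a22 x11 x12 x21 x22. *)
Definition bits (n : nat) : oct8 :=
  let b k := odd (iter k half n) in
  (b 0, b 1, b 2, b 3, (b 4, b 5, b 6, b 7))%N.
Definition unbits (u : oct8) : seq bool :=
  let: (b0, b1, b2, b3, (b4, b5, b6, b7)) := u in
  [:: b0; b1; b2; b3; b4; b5; b6; b7].

Local Notation o0 := (bits 0).
Local Notation o1 := (bits 9).

Definition osum (s : seq oct8) : oct8 := foldr oadd o0 s.
Definition units8 : seq oct8 := [seq bits (2 ^ k) | k <- iota 0 8].

Lemma qaddA : associative qadd.
Proof. by move=> [[[? ?] ?] ?] [[[? ?] ?] ?] [[[? ?] ?] ?]; rewrite /= !addbA. Qed.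
Lemma qaddC : commutative qadd.
Proof.
move=> [[[a b] c] d] [[[x y] z] t].
by rewrite /= (addbC a) (addbC b) (addbC c) (addbC d).
Qed.
Lemma oaddA : associative oadd.
Proof. by move=> u v w; rewrite /oadd /= !qaddA. Qed.
Lemma oaddC : commutative oadd.
Proof. by move=> u v; rewrite /oadd (qaddC u.1) (qaddC u.2). Qed.
Lemma oaddCA : left_commutative oadd.
Proof. by move=> u v w; rewrite !oaddA (oaddC u). Qed.
Lemma add0o : left_id o0 oadd.
Proof. by case=> [[[[? ?] ?] ?] [[[? ?] ?] ?]]. Qed.

Lemma addo0 : right_id o0 oadd.
Proof. by move=> u; rewrite oaddC add0o. Qed.
Lemma addoo u : oadd u u = o0.
Proof. by case: u => [[[[? ?] ?] ?] [[[? ?] ?] ?]]; rewrite /oadd /= !addbb. Qed.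

Lemma oaddK u v : oadd (oadd u v) v = u.
Proof. by rewrite -oaddA addoo addo0. Qed.

Lemma osum_units u : osum (mask (unbits u) units8) = u.
Proof.
by move: u => [[[[[] []] []] []] [[[[] []] []] []]]; vm_compute.
Qed.

Definition all_oct8 : seq oct8 := [seq bits n | n <- iota 0 256].

Lemma mem_all_oct8 u : u \in all_oct8.
Proof.
by move: u => [[[[[] []] []] []] [[[[] []] []] []]]; vm_compute.
Qed.

Lemma oct8_ind (P : pred oct8) : all P all_oct8 -> forall u, P u.
Proof. by move/allP=> allP u; apply/allP/mem_all_oct8. Qed.

Lemma omul1o : left_id o1 omul.
Proof. by move=> u; apply/eqP; move: u; apply: oct8_ind; vm_compute. Qed.
Lemma omulo1 : right_id o1 omul.
Proof. by move=> u; apply/eqP; move: u; apply: oct8_ind; vm_compute. Qed.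

Lemma additive_osum (f : oct8 -> oct8) s :
  {morph f : u v / oadd u v} -> f (osum s) = osum (map f s).
Proof.
move=> fD; have f0 : f o0 = o0.
  have := fD o0 o0; rewrite add0o => e.
  by rewrite e addoo.
by elim: s => //= u s <-; rewrite fD.
Qed.

Lemma additive_ext (f g : oct8 -> oct8) :
  {morph f : u v / oadd u v} -> {morph g : u v / oadd u v} ->
  {in units8, f =1 g} -> f =1 g.
Proof.
move=> fD gD fg u; rewrite -(osum_units u) !additive_osum //.
by congr osum; apply/eq_in_map => v /mem_mask; apply: fg.
Qed.

Lemma qmulDl a : {morph qmul^~ a : u v / qadd u v}.
Proof.
move: a => [[[a b] c] d] [[[x y] z] t] [[[x' y'] z'] t'] /=.
rewrite !andb_addl.
by congr (_, _, _, _); apply: addbACA.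
Qed.
Lemma qmulDr a : {morph qmul a : u v / qadd u v}.
Proof.
move: a => [[[a b] c] d] [[[x y] z] t] [[[x' y'] z'] t'] /=.
rewrite !andb_addr.
by congr (_, _, _, _); apply: addbACA.
Qed.
Lemma qconjD : {morph qconj : u v / qadd u v}.
Proof. by move=> [[[? ?] ?] ?] [[[? ?] ?] ?]. Qed.

Lemma qaddACA : interchange qadd qadd.
Proof. by move=> a b c d; rewrite -!qaddA (qaddA b) (qaddC b) -qaddA. Qed.

Lemma omulDl a : {morph omul^~ a : u v / oadd u v}.
Proof.
by move=> u v; rewrite /omul /oadd /= !(qmulDl, qmulDr); congr pair; apply: qaddACA.
Qed.
Lemma omulDr a : {morph omul a : u v / oadd u v}.
Proof.
move=> u v; rewrite /omul /oadd /= !(qconjD, qmulDl, qmulDr).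
by congr pair; apply: qaddACA.
Qed.

Definition oct_hom (f : oct8 -> oct8) : Prop :=
  {morph f : u v / oadd u v} /\ {morph f : u v / omul u v}.

(** By biadditivity of the product, the 64 products of basis vectors suffice. *)
Lemma oct_hom_units f : {morph f : u v / oadd u v} ->
  all (fun u => all (fun v => f (omul u v) == omul (f u) (f v)) units8) units8 ->
  oct_hom f.
Proof.
move=> fD /allP fM; split=> // u v; move: u.
apply: additive_ext => [u w|u w|u uU]; rewrite ?omulDl ?fD ?omulDl //.
move: v; apply: additive_ext => [v w|v w|v vU]; rewrite ?(omulDr, fD) //.
by apply/eqP/(allP (fM u uU)).
Qed.

Definition linmap (im : seq nat) (u : oct8) : oct8 :=
  osum (mask (unbits u) (map bits im)).

Lemma osum_mask_addb m1 m2 l : size m1 = size m2 ->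
  osum (mask [seq b.1 (+) b.2 | b <- zip m1 m2] l) =
  oadd (osum (mask m1 l)) (osum (mask m2 l)).
Proof.
elim: l m1 m2 => [|u l IHl] [|b1 m1] [|b2 m2] //= [eqm]; rewrite ?add0o //.
by case: b1 b2 => [] [] /=; rewrite IHl //; [rewrite oaddCA -oaddA (oaddA u u)
  addoo add0o | rewrite oaddA | rewrite oaddCA].
Qed.

Lemma linmapD im : {morph linmap im : u v / oadd u v}.
Proof.
move=> u v; rewrite /linmap -osum_mask_addb.
  by move: u v => [[[[? ?] ?] ?] [[[? ?] ?] ?]] [[[[? ?] ?] ?] [[[? ?] ?] ?]].
by move: u v => [[[[? ?] ?] ?] [[[? ?] ?] ?]] [[[[? ?] ?] ?] [[[? ?] ?] ?]].
Qed.

(* Found by computer search: the automorphisms that permute the subalgebras   *)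
(* generated by the octonions cgen k below according to the tables above.     *)
Definition lin_d := linmap [:: 53; 31; 36; 60; 16; 48; 118; 235]%N.
Definition lin_f := linmap [:: 5; 15; 4; 12; 16; 48; 80; 240]%N.
Definition lin_t := linmap [:: 215; 185; 105; 222; 125; 155; 235; 118]%N.
Definition lin_w := linmap [:: 1; 18; 4; 8; 16; 32; 80; 164]%N.

Lemma lin_d_hom : oct_hom lin_d.
Proof. by apply: oct_hom_units; [apply: linmapD | vm_compute]. Qed.
Lemma lin_f_hom : oct_hom lin_f.
Proof. by apply: oct_hom_units; [apply: linmapD | vm_compute]. Qed.
Lemma lin_t_hom : oct_hom lin_t.
Proof. by apply: oct_hom_units; [apply: linmapD | vm_compute]. Qed.
Lemma lin_w_hom : oct_hom lin_w.
Proof. by apply: oct_hom_units; [apply: linmapD | vm_compute]. Qed.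

Lemma oct_hom_comp f g : oct_hom f -> oct_hom g -> oct_hom (f \o g).
Proof.
by move=> [fD fM] [gD gM]; split=> u v /=; rewrite ?gD ?gM ?fD ?fM.
Qed.

Lemma oct_hom_iter n f : oct_hom f -> oct_hom (iter n f).
Proof. by move=> hf; elim: n => // n IHn; apply: oct_hom_comp hf IHn. Qed.

Lemma oct_hom_inj n f :
  oct_hom f -> all (fun u => iter n.+1 f u == u) units8 -> injective f.
Proof.
move=> hf /allP fn; apply: (@can_inj _ _ _ (iter n f)) => u.
rewrite -iterSr; move: u; apply: additive_ext => // [|u uU].
  exact: (oct_hom_iter n.+1 hf).1.
exact/eqP/fn.
Qed.

Definition words (c d e : oct8) : seq oct8 :=
  [:: o1; c; d; omul c d; e; omul c e; omul d e; omul c (omul d e)].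

(* One generator for each of the 28 subalgebras isomorphic to F_4, numbered   *)
(* along an isomorphism from the design of the unital: the blocks are the     *)
(* sets of subalgebras contained in a 4-dimensional subalgebra.               *)
Definition c_list : seq nat :=
  [:: 14; 30; 46; 62; 78; 142; 206; 94; 174; 254; 122; 156; 232; 120; 154; 236;
      124; 152; 234; 106; 188; 216; 108; 184; 218; 104; 186; 220].
Definition cgen (k : nat) : oct8 := bits (nth 0 c_list k)%N.

Lemma oct_hom_words f c d e : oct_hom f -> f o1 = o1 ->
  map f (words c d e) = words (f c) (f d) (f e).
Proof. by move=> [fD fM] f1; rewrite /= !fM f1. Qed.

(** The eight words span the octonions, so [cgen 0], [cgen 1] and [bits 64] generate the algebra.
    The numbers encode the standard basis vectors in terms of the words. *)
Lemma units_words :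
  units8 = [seq osum (mask m (words (cgen 0) (cgen 1) (bits 64))) |
    m <- map unbits (map bits [:: 208; 179; 96; 209; 6; 11; 16; 32])]%N.
Proof. by vm_compute. Qed.

Lemma oct_hom_ext f g : oct_hom f -> oct_hom g -> f o1 = o1 -> g o1 = o1 ->
  f (cgen 0) = g (cgen 0) -> f (cgen 1) = g (cgen 1) ->
  f (bits 64) = g (bits 64) -> f =1 g.
Proof.
move=> hf hg f1 g1 e0 e1 e2; apply: additive_ext hf.1 hg.1 _ => u.
rewrite units_words => /mapP[m _ ->].
rewrite !additive_osum ?hf.1 ?hg.1 //; try by [case: hf | case: hg].
by rewrite !map_mask !oct_hom_words // e0 e1 e2.
Qed.

(** When c^2 = c + 1, these are the two primitive elements of {0, 1, c, c + 1}. *)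
Definition F4_gen (c u : oct8) : bool := (u == c) || (u == oadd c o1).

(* Among the possible images of cgen 0, cgen 1 and bits 64, these relations   *)
(* leave exactly the 16 triples obtained from powers of lin_d and lin_f.      *)
Definition relator (x : oct8 * oct8 * oct8) : bool :=
  let: (c, d, e) := x in
  if omul e e == o0 then
    omul (omul c d) e == osum [:: o1; omul c e; omul d e; omul c (omul d e)]
  else false.

Definition exps : seq (nat * nat) := [seq (i, j) | i <- iota 0 8, j <- iota 0 2].
Definition img (ij : nat * nat) (u : oct8) : oct8 :=
  iter ij.2 lin_f (iter ij.1 lin_d u).

Lemma relator_images :
  all [in [seq (img ij (cgen 0), img ij (cgen 1), img ij (bits 64)) | ij <- exps]]
    [seq x <- [seq (cd, e) | cd <- [seq (c, d) |
                 c <- [:: cgen 0; oadd (cgen 0) o1],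
                 d <- [:: cgen 1; oadd (cgen 1) o1]], e <- all_oct8]
         | relator x].
Proof. by vm_compute. Qed.

Lemma two_generator_stabilizer f : oct_hom f -> f o1 = o1 ->
  F4_gen (cgen 0) (f (cgen 0)) -> F4_gen (cgen 1) (f (cgen 1)) ->
  exists i j, [/\ (i < 8)%N, (j < 2)%N & f =1 iter j lin_f \o iter i lin_d].
Proof.
move=> hf f1 F0 F1.
have [fD fM] := hf; have f0 : f o0 = o0 by apply: (additive_osum [::] fD).
(* The original triple satisfies the relations, and a homomorphism fixing 1 carries them over to the
   images. *)
have relf : relator (f (cgen 0), f (cgen 1), f (bits 64)).
  rewrite /relator -!fM (_ : omul (bits 64) (bits 64) = o0) // f0 eqxx.
  rewrite -f1 -(additive_osum [:: _; _; _; _] fD); apply/eqP/(congr1 f).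
  by vm_compute.
have /mapP[[i j]] : (f (cgen 0), f (cgen 1), f (bits 64)) \in
    [seq (img ij (cgen 0), img ij (cgen 1), img ij (bits 64)) | ij <- exps].
  apply: (allP relator_images); rewrite mem_filter relf.
  apply/allpairsP; exists ((f (cgen 0), f (cgen 1)), f (bits 64)).
  split; rewrite ?mem_all_oct8 //; apply/allpairsP.
  by exists (f (cgen 0), f (cgen 1)); split; rewrite // !inE.
case/allpairsP=> -[i' j'] [+ + [-> ->]]; rewrite !mem_iota => /= lti ltj.
case=> e0 e1 e2; exists i', j'; split=> //.
have hd := oct_hom_iter i' lin_d_hom; have hfj := oct_hom_iter j' lin_f_hom.
have hij := oct_hom_comp hfj hd.
apply: oct_hom_ext => //=.
rewrite (_ : iter i' lin_d o1 = o1); last by elim: (i') => //= n ->; vm_compute.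
by elim: (j') => //= n ->; vm_compute.
Qed.

(** * Transfer from Boolean coordinates to matrices, and the 28 subalgebras *)

Section Octonions.
Local Open Scope ring_scope.

Lemma F2_cases (x : 'F_2) : x = (x == 1)%:R.
Proof. by apply: val_inj; case: x => [[|[]]]. Qed.

Lemma natr_addb (b c : bool) : (b (+) c)%:R = b%:R + c%:R :> 'F_2.
Proof. by apply: val_inj; case: b c => [] []. Qed.

Lemma natr_andb (b c : bool) : (b && c)%:R = b%:R * c%:R :> 'F_2.
Proof. by apply: val_inj; case: b c => [] []. Qed.

Lemma F2_opp (x : 'F_2) : - x = x.
Proof. by apply: val_inj; case: x => [[|[]]]. Qed.

Lemma F2_addrr (x : 'F_2) : x + x = 0.
Proof. by rewrite -{2}[x]F2_opp subrr. Qed.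

Lemma natb_eq1 (b : bool) : (b%:R == 1 :> 'F_2) = b.
Proof. by case: b. Qed.

Definition mxq (a : quat) : 'M['F_2]_2 :=
  let: (a0, a1, a2, a3) := a in
  \matrix_(i, j) (nth false [:: a0; a1; a2; a3] (i * 2 + j))%:R.

Definition qmx (A : 'M['F_2]_2) : quat :=
  (A 0 0 == 1, A 0 1 == 1, A 1 0 == 1, A 1 1 == 1).

Lemma mxqK : cancel mxq qmx.
Proof. by case=> [[[a b] c] d]; rewrite /qmx !mxE !natb_eq1. Qed.

Lemma ord2_ind (P : 'I_2 -> Prop) : P 0 -> P 1 -> forall i, P i.
Proof.
move=> P0 P1 [[|[|//]] lti]; [move: P0 | move: P1];
  by congr P; apply: val_inj.
Qed.

Lemma qmxK : cancel qmx mxq.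
Proof.
move=> A; apply/matrixP; apply: ord2_ind; apply: ord2_ind;
  by rewrite !mxE /= -F2_cases.
Qed.

Lemma mxqD a b : mxq (qadd a b) = mxq a + mxq b.
Proof.
move: a b => [[[a0 a1] a2] a3] [[[b0 b1] b2] b3].
by apply/matrixP; apply: ord2_ind; apply: ord2_ind; rewrite !mxE /= natr_addb.
Qed.

Lemma mxqM a b : mxq (qmul a b) = mxq a *m mxq b.
Proof.
move: a b => [[[a0 a1] a2] a3] [[[b0 b1] b2] b3].
apply/matrixP; apply: ord2_ind; apply: ord2_ind;
  by rewrite !mxE big_ord_recl big_ord1 !mxE /= natr_addb !natr_andb.
Qed.

Lemma mxq_conj a : mxq (qconj a) = quat_conj (mxq a).
Proof.
move: a => [[[a0 a1] a2] a3]; rewrite /quat_conj /mxtrace big_ord_recl big_ord1.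
apply/matrixP; apply: ord2_ind; apply: ord2_ind;
  rewrite !mxE /= ?mulr1n ?mulr0n ?sub0r ?F2_opp //.
  by rewrite addrAC F2_addrr add0r.
by rewrite -addrA F2_addrr addr0.
Qed.

Definition octb (u : oct8) : octonion 'F_2 := (mxq u.1, mxq u.2).
Definition boct (u : octonion 'F_2) : oct8 := (qmx u.1, qmx u.2).

Lemma octbK : cancel octb boct.
Proof. by case=> a b; rewrite /boct !mxqK. Qed.
Lemma boctK : cancel boct octb.
Proof. by case=> a b; rewrite /octb !qmxK. Qed.

Lemma octbD u v : octb (oadd u v) = octb u + octb v.
Proof. by rewrite /octb !mxqD. Qed.
Lemma octbM u v : octb (omul u v) = oct_mul (octb u) (octb v).
Proof. by rewrite /octb /oct_mul !mxqD !mxqM !mxq_conj. Qed.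
Lemma oct_mulDl (x u v : octonion 'F_2) :
  oct_mul (u + v) x = oct_mul u x + oct_mul v x.
Proof.
rewrite -(boctK x) -(boctK u) -(boctK v).
by rewrite -octbD -!octbM -octbD omulDl.
Qed.
Lemma oct_mulDr (x u v : octonion 'F_2) :
  oct_mul x (u + v) = oct_mul x u + oct_mul x v.
Proof.
rewrite -(boctK x) -(boctK u) -(boctK v).
by rewrite -octbD -!octbM -octbD omulDr.
Qed.
Lemma octb0 : octb o0 = 0.
Proof.
by congr pair; apply/matrixP; apply: ord2_ind; apply: ord2_ind; rewrite !mxE /=.
Qed.

Lemma octonion_scale (a : 'F_2) (u : octonion 'F_2) :
  a *: u = if a == 1 then u else 0.
Proof. by rewrite [a in LHS]F2_cases; case: eqP; rewrite ?scale1r ?scale0r. Qed.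

Lemma additive_linear (f : octonion 'F_2 -> octonion 'F_2) :
  {morph f : u v / u + v} -> linear f.
Proof.
move=> fD a u v; rewrite fD !octonion_scale; case: ifP => // _; congr (_ + _).
by apply: (@addrI _ (f 0)); rewrite -fD !addr0.
Qed.

Lemma oct_aut_of_hom (f : oct8 -> oct8) : oct_hom f -> injective f ->
  exists2 g, g \in oct_aut 'F_2 & forall u, g (octb u) = octb (f u).
Proof.
move=> [fD fM] finj; pose F u := octb (f (boct u)).
have Finj : injective F.
  by move=> u v /(can_inj octbK)/finj/(can_inj boctK).
exists (perm Finj) => [|u]; last by rewrite permE /F octbK.
rewrite inE; apply/asboolP; split=> [|u v]; last first.
  rewrite !permE /F -octbM -fM -{1}(boctK u) -{1}(boctK v) -octbM octbK //.
apply: additive_linear => u v.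
by rewrite !permE /F -octbD -fD -{1}(boctK u) -{1}(boctK v) -octbD octbK.
Qed.

Lemma oct_aut_hom (g : {perm octonion 'F_2}) : g \in oct_aut 'F_2 ->
  oct_hom (boct \o g \o octb).
Proof.
rewrite inE => /asboolP[gL gM]; split=> u v; apply: (can_inj octbK) => /=.
  rewrite !(boctK, octbD); have := gL 1 (octb u) (octb v).
  by rewrite !scale1r.
by rewrite !(boctK, octbM) gM.
Qed.

(** Preservation of 1 is not part of [oct_aut]; it follows because a surjective multiplicative map
    sends a two-sided unit to a two-sided unit. *)
Lemma oct_aut_one (g : {perm octonion 'F_2}) : g \in oct_aut 'F_2 ->
  (boct \o g \o octb) o1 = o1.
Proof.
move=> /oct_aut_hom[_ fM]; set f := _ \o _ in fM *.
have fK : cancel (boct \o g^-1%g \o octb) f.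
  by move=> u; rewrite /f /= boctK permKV octbK.
by rewrite -[f o1]omulo1 -{2}(fK o1) -fM omul1o fK.
Qed.


Definition F4_seq (c : oct8) : seq oct8 := [:: o0; o1; c; oadd c o1].
Definition F4_set (c : oct8) : {set octonion 'F_2} :=
  [set x | boct x \in F4_seq c].
Definition F4_point (k : 'I_28) : {set octonion 'F_2} := F4_set (cgen k).

Lemma F4_setP c u : (octb u \in F4_set c) = (u \in F4_seq c).
Proof. by rewrite inE octbK. Qed.

Lemma F4_set_gen c d : F4_gen c d -> F4_set d = F4_set c.
Proof.
case/orP=> /eqP-> //; apply/setP=> x; rewrite !inE.
by rewrite -oaddA addoo addo0 (orbC (_ == oadd _ _)).
Qed.

Lemma F4_point_inj : injective F4_point.
Proof.
move=> k l /setP/(_ (octb (cgen k))); rewrite !F4_setP !inE eqxx !orbT.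
have T : all (fun k => all (fun l => (cgen k \in F4_seq (cgen l)) ==> (k == l))
  (iota 0 28)) (iota 0 28) by vm_compute.
have := allP (allP T k _) l; rewrite !mem_iota !ltn_ord.
move=> /(_ isT isT)/implyP; rewrite !inE => kl /esym/kl/eqP.
exact: val_inj.
Qed.

Lemma oct_aut_F4_set g c : g \in oct_aut 'F_2 ->
  [set g x | x in F4_set c] = F4_set ((boct \o g \o octb) c).
Proof.
move=> Ag; have [fD fM] := oct_aut_hom Ag; have f1 := oct_aut_one Ag.
set f := _ \o _ in fD fM f1 *.
have finj : injective f.
  by move=> u v /(can_inj boctK)/perm_inj/(can_inj octbK).
have f0 : f o0 = o0 by apply: (additive_osum [::] fD).
apply/setP=> x; rewrite -[x](permKV g) (mem_imset _ _ perm_inj) !in_set.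
have -> : boct (g (g^-1%g x)) = f (boct (g^-1%g x)) by rewrite /f /= boctK.
have <- : map f (F4_seq c) = F4_seq (f c) by rewrite /= fD f0 f1.
by rewrite mem_map.
Qed.

End Octonions.

(** * Classification of the subalgebras isomorphic to the field of four elements *)

Section FieldF4.
Local Open Scope ring_scope.
Variables (F4 : fieldExtType 'F_2).
Hypothesis dimF4 : (\dim {:F4} = 2)%N.

Lemma F4_scale (a : 'F_2) (x : F4) : a *: x = if a == 1 then x else 0.
Proof. by rewrite [a in LHS]F2_cases; case: eqP; rewrite ?scale1r ?scale0r. Qed.

Lemma F4_addrr (x : F4) : x + x = 0.
Proof. by rewrite -[x]scale1r -scalerDl F2_addrr scale0r. Qed.

(** Take w outside F_2. Of the four possible values of w^2 in the basis (w, 1), all but w + 1 force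
    w to be 0 or 1, by the absence of zero divisors and (w + 1)^2 = w^2 + 1. *)
Lemma F4_generator : exists w : F4,
  w * w = w + 1 /\ basis_of {:F4} [tuple w; 1].
Proof.
have /subvPn[w _ w1] : ~~ ({:F4} <= <[1]>)%VS.
  by apply: contraL isT => /dimvS; rewrite dimF4 dim_vline oner_neq0.
have bas : basis_of {:F4} [tuple w; 1].
  by rewrite basisEfree free_cons span_seq1 w1 seq1_free oner_neq0 subvf dimF4.
exists w; split=> //.
have := coord_basis bas (memvf (w * w)); rewrite !big_ord_recl big_ord0 addr0 /=.
rewrite !F4_scale.
have wk (k : 'F_2) : w != k *: 1 by apply: contra w1 => /eqP->; apply/vlineP; exists k.
have w0 := wk 0; have w_1 := wk 1; rewrite ?scale0r ?scale1r in w0 w_1.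
case: ifP => _; case: ifP => _ e; rewrite ?(addr0, add0r) // in e.
- by case/eqP: w_1; apply: (mulfI w0); rewrite e mulr1.
- have /eqP : (w + 1) * (w + 1) = 0.
    by rewrite mulrDl !mulrDr e !mulr1 mul1r (addrC w) F4_addrr.
  rewrite mulf_eq0 orbb addr_eq0 => /eqP ew; case/eqP: w_1.
  by apply: (@addIr _ 1); rewrite F4_addrr ew addNr.
by move/eqP: e; rewrite mulf_eq0 orbb (negPf w0).
Qed.

Lemma F4_elements (w x : F4) : basis_of {:F4} [tuple w; 1] ->
  x \in [:: 0; 1; w; w + 1].
Proof.
move=> bas; rewrite (coord_basis bas (memvf x)) !big_ord_recl big_ord0 addr0 /=.
rewrite !F4_scale; do 2!case: ifP => _;
  by rewrite ?(addr0, add0r) !inE eqxx ?orbT.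
Qed.

(* If u is the image of a generator of F_4, then u^2 + u is the image of 1,   *)
(* which is not assumed to be the unit of the octonions.                      *)
Lemma unital_F4 u : let e := oadd (omul u u) u in
  e != o0 -> omul e u = u ->
  e = o1 /\ exists k : 'I_28, F4_gen (cgen k) u.
Proof.
move=> e; pose P u := let e := oadd (omul u u) u in
  if e == o0 then true else if omul e u == u then
  (e == o1) && has (fun k => F4_gen (cgen k) u) (iota 0 28) else true.
have /oct8_ind/(_ u) : all P all_oct8 by vm_compute.
rewrite /P -/e => + /negPf e0 eu; rewrite e0 eu eqxx.
case/andP=> /eqP-> /hasP[k]; rewrite mem_iota add0n => ltk gk.
by split=> //; exists (Ordinal (ltk : (k < 28)%N)).
Qed.

Lemma cgen_sq (k : 'I_28) : omul (cgen k) (cgen k) = oadd (cgen k) o1.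
Proof.
have /allP/(_ k) : all (fun k => omul (cgen k) (cgen k) == oadd (cgen k) o1)
  (iota 0 28) by vm_compute.
by rewrite mem_iota ltn_ord => /(_ isT)/eqP.
Qed.

Lemma F4_point_subalgebra k : subalgebra (F4_point k).
Proof.
have closed u v : u \in F4_seq (cgen k) -> v \in F4_seq (cgen k) ->
    (oadd u v \in F4_seq (cgen k)) && (omul u v \in F4_seq (cgen k)).
  have T : all (fun k => let F := F4_seq (cgen k) in
      all (fun u => all (fun v => (oadd u v \in F) && (omul u v \in F)) F) F)
    (iota 0 28) by vm_compute.
  have := allP T k; rewrite mem_iota ltn_ord => /(_ isT) Tk uF vF.
  by have /allP/(_ v vF) := allP Tk u uF.
rewrite /F4_point; split=> [|x y]; last first.
  rewrite -[x]boctK -[y]boctK -octbM !F4_setP => xF yF.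
  by case/andP: (closed _ _ xF yF).
split=> [|a x y]; first by rewrite -octb0 F4_setP.
rewrite octonion_scale; case: ifP => _; last by rewrite add0r.
rewrite -[x]boctK -[y]boctK -octbD !F4_setP => xF yF.
by case/andP: (closed _ _ xF yF).
Qed.

(** An embedding is determined by the image of a generator, which [unital_F4] locates among the
    listed ones. Conversely each [cgen k] satisfies c^2 = c + 1, so sending w to it defines an
    embedding. *)
Lemma subalgebras_iso_F4 : subalgebras_iso F4 = F4_point @: setT.
Proof.
have [w [ww bas]] := F4_generator.
have F4E := F4_elements _ bas.
apply/setP=> A; rewrite inE; apply/asboolP/imsetP=> [[_ [f [finj fM fA]]]|].
  pose u := boct (f w); pose e := boct (f 1).
  (* In characteristic 2, w^2 = w + 1 reads 1 = w^2 + w. *)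
  have eE : e = oadd (omul u u) u.
    apply: (can_inj octbK); rewrite !(octbD, octbM, boctK) -fM -raddfD ww.
    by rewrite addrAC F4_addrr add0r.
  have e0 : e != o0.
    apply: contra (oner_neq0 F4) => /eqP e0; apply/eqP/finj.
    by rewrite raddf0 -[f 1]boctK -/e e0 octb0.
  have eu : omul e u = u.
    by apply: (can_inj octbK); rewrite octbM !boctK -fM mul1r.
  have [e1 [k gk]] : e = o1 /\ exists k : 'I_28, F4_gen (cgen k) u.
    by rewrite eE; apply: unital_F4; rewrite -eE.
  exists k => //; rewrite /F4_point -(F4_set_gen gk); apply/setP=> x.
  have fw : f w = octb u by rewrite boctK.
  have f1 : f 1 = octb o1 by rewrite -e1 boctK.
  have fw1 : f (w + 1) = octb (oadd u o1).
    by rewrite raddfD /= fw f1 -octbD.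
  have f0 : f 0 = octb o0 by rewrite raddf0 octb0.
  rewrite -[x]boctK F4_setP; apply/idP/idP.
    move/fA=> [y /(congr1 boct)]; rewrite octbK => <-; move: (F4E y).
    rewrite !inE => /or4P[] /eqP->; rewrite ?fw1 ?fw ?f1 ?f0;
    by rewrite octbK eqxx ?orbT.
  rewrite !inE => /or4P[] /eqP->; apply/fA; [exists 0|exists 1|exists w|exists (w+1)];
  by rewrite ?fw1 ?fw ?f1 ?f0.
case=> k _ ->; split.
  exact: F4_point_subalgebra.
pose c1 x := coord [tuple w; 1] 1 x; pose cw x := coord [tuple w; 1] 0 x.
pose f x := cw x *: octb (cgen k) + c1 x *: octb o1.
have f_lin : linear f.
  have cwP a x y : cw (a *: x + y) = a * cw x + cw y by rewrite /cw linearP.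
  have c1P a x y : c1 (a *: x + y) = a * c1 x + c1 y by rewrite /c1 linearP.
  move=> a x y; rewrite /f cwP c1P.
  have ACA (p q r s : octonion 'F_2) : p + q + (r + s) = p + r + (q + s).
    exact: addrACA.
  rewrite !scalerDl scalerDr !scalerA; exact: ACA.
pose F : {linear F4 -> octonion 'F_2} :=
  HB.pack f (GRing.isLinear.Build _ _ _ _ f f_lin).
have FD x y : F (x + y) = F x + F y by apply: raddfD.
have fr : free [tuple w; 1] by case/andP: bas.
have f1 : F 1 = octb o1.
  have c i : coord [tuple w; 1] i 1 = (1 == i)%:R := coord_free 1 i fr.
  by rewrite /F /= /f /cw /c1 !c /= scale0r add0r scale1r.
have fw : F w = octb (cgen k).
  have c i : coord [tuple w; 1] i w = (0 == i)%:R := coord_free 0 i fr.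
  by rewrite /F /= /f /cw /c1 !c /= scale0r addr0 scale1r.
clearbody F => {f f_lin c1 cw}.
have f0 : F 0 = octb o0 by rewrite raddf0 octb0.
have fw1 : F (w + 1) = octb (oadd (cgen k) o1).
  by rewrite FD fw f1 octbD.
exists F; split.
- apply: raddf_inj => x Fx0; have {}Fx0 : boct (F x) = o0.
    by rewrite Fx0 -octb0 octbK.
  move: (F4E x) Fx0; rewrite !inE => /or4P[] /eqP-> //;
    rewrite ?fw1 ?fw ?f1 octbK // => e; have := cgen_sq k.
    by rewrite e.
  by have := oaddK (cgen k) o1; rewrite e add0o => <-.
(* Multiplicativity is biadditive in the pair, so it spreads from the basis w, 1 to all four
   elements. *)
- pose P x y := F (x * y) = oct_mul (F x) (F y).
  have PDl x y z : P x z -> P y z -> P (x + y) z.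
    by rewrite /P mulrDl !FD => -> ->; rewrite oct_mulDl.
  have PDr x y z : P x y -> P x z -> P x (y + z).
    by rewrite /P mulrDr !FD => -> ->; rewrite oct_mulDr.
  have P11 : P 1 1 by rewrite /P mulr1 f1 -octbM.
  have Pw1 : P w 1 by rewrite /P mulr1 f1 fw -octbM omulo1.
  have P1w : P 1 w by rewrite /P mul1r f1 fw -octbM omul1o.
  have Pww : P w w by rewrite /P ww fw1 fw -octbM cgen_sq.
  have P10 : P 1 0 by have := PDr 1 1 1 P11 P11; rewrite F4_addrr.
  have Pw0 : P w 0 by have := PDr w 1 1 Pw1 Pw1; rewrite F4_addrr.
  have P1 x : P 1 x.
    move: (F4E x); rewrite !inE => /or4P[] /eqP->;
      [exact: P10 | exact: P11 | exact: P1w | exact: (PDr 1 w 1)].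
  have Pw x : P w x.
    move: (F4E x); rewrite !inE => /or4P[] /eqP->;
      [exact: Pw0 | exact: Pw1 | exact: Pww | exact: (PDr w w 1)].
  have P0 x : P 0 x by have := PDl 1 1 x (P1 x) (P1 x); rewrite F4_addrr.
  have PP x y : P x y.
    move: (F4E x); rewrite !inE => /or4P[] /eqP->;
      [exact: P0 | exact: P1 | exact: Pw | exact: (PDl w 1 y (Pw y) (P1 y))].
  exact: PP.
- move=> u; rewrite -[u]boctK F4_setP !inE; split=> [/or4P[] /eqP-> | [x]].
  + by exists 0.
  + by exists 1.
  + by exists w.
  + by exists (w + 1).
  move=> xu; have <- : boct (F x) = boct u by rewrite xu octbK.
  move: (F4E x); rewrite !inE => /or4P[] /eqP->;
  by rewrite ?fw1 ?fw ?f1 ?f0 octbK eqxx ?orbT.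
Qed.
End FieldF4.

(** * The permutation group induced by the octonion automorphisms *)

Section OctonionGroup.
Local Open Scope group_scope.

Lemma setactPE (T : finType) (A : {set T}) (g : {perm T}) :
  ('P^* A g)%act = [set g x | x in A].
Proof. by []. Qed.

(** The equation c^2 + c = 1 is preserved, and [unital_F4] puts all its solutions in the list. *)
Lemma acts_F4_points : [acts oct_aut 'F_2, on F4_point @: setT | 'P^*].
Proof.
apply/subsetP=> g Ag; rewrite !inE; apply/subsetP=> _ /imsetP[k _ ->].
have [fD fM] := oct_aut_hom Ag; have f1 := oct_aut_one Ag.
rewrite inE setactPE oct_aut_F4_set //.
set f := _ \o _ in fD fM f1 *.
have e1 : oadd (omul (f (cgen k)) (f (cgen k))) (f (cgen k)) = o1.
  by rewrite -fM cgen_sq fD f1 oaddC oaddA addoo add0o.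
have [|| _ [l gl]] := @unital_F4 (f (cgen k)); rewrite ?e1 ?omul1o //.
by apply/imsetP; exists l; rewrite // (F4_set_gen gl).
Qed.

Definition oct_perm := index_perm (0%R : 'I_28) F4_point_inj acts_F4_points.

Lemma oct_perm_realizes g f (tab : seq nat) : g \in oct_aut 'F_2 ->
    (forall u, g (octb u) = octb (f u)) ->
    all (fun k => F4_gen (cgen (nth 0%N tab k)) (f (cgen k))) (iota 0 28) ->
    all (gtn 28) tab -> realizes (oct_perm g) tab.
Proof.
move=> Ag gf /allP tabk /allP tab28 k.
have lt28 : (nth 0%N tab k < 28)%N.
  have [/(mem_nth 0%N)/tab28 // | /(nth_default 0%N)-> //] := ltnP k (size tab).
suff -> : oct_perm g k = Ordinal lt28 by [].
apply: index_permP => //; rewrite setactPE oct_aut_F4_set //.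
rewrite /F4_point /= gf octbK; apply: F4_set_gen.
by apply: tabk; rewrite mem_iota ltn_ord.
Qed.

Lemma oct_perm_image :
  'injm oct_perm /\ exists d f t w : {perm 'I_28},
    [/\ realizes d tab_d, realizes f tab_f, realizes t tab_t, realizes w tab_w
      & oct_perm @* oct_aut 'F_2 = <<[set d; f; t; w]>>].
Proof.
(* The first argument of [oct_hom_inj] here and below is one less than an exponent killing the map:
   8, 2, 3 and 2. *)
have [|d Ad dE] := oct_aut_of_hom lin_d_hom.
  by apply: (@oct_hom_inj 7 _ lin_d_hom); vm_compute.
have [|f Af fE] := oct_aut_of_hom lin_f_hom.
  by apply: (@oct_hom_inj 1 _ lin_f_hom); vm_compute.
have [|t At tE] := oct_aut_of_hom lin_t_hom.
  by apply: (@oct_hom_inj 2 _ lin_t_hom); vm_compute.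
have [|w Aw wE] := oct_aut_of_hom lin_w_hom.
  by apply: (@oct_hom_inj 1 _ lin_w_hom); vm_compute.
have rd : realizes (oct_perm d) tab_d by apply: (oct_perm_realizes Ad dE); vm_compute.
have rf : realizes (oct_perm f) tab_f by apply: (oct_perm_realizes Af fE); vm_compute.
have rt : realizes (oct_perm t) tab_t by apply: (oct_perm_realizes At tE); vm_compute.
have rw : realizes (oct_perm w) tab_w by apply: (oct_perm_realizes Aw wE); vm_compute.
have [|injr imr _ _] := tables_image Ad Af At Aw rd rf rt rw.
  move=> g Ag g0 g1.
  (* The image of [cgen k] lies in the fixed subalgebra and cannot be 0 or 1, since neither solves
     c^2 = c + 1. *)
  have F4g k : oct_perm g k = k -> F4_gen (cgen k) ((boct \o g \o octb) (cgen k)).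
    move=> gk; have := index_permE 0%R F4_point_inj acts_F4_points k Ag.
    rewrite -/oct_perm gk setactPE oct_aut_F4_set // => /setP.
    set c' := (_ \o _) _; move/(_ (octb c')); rewrite !F4_setP.
    have e1 : omul c' c' = oadd c' o1.
      have [fD fM] := oct_aut_hom Ag; have f1 := oct_aut_one Ag.
      by rewrite /c' -fM cgen_sq fD f1.
    rewrite [RHS](_ : _ = true); last by rewrite !inE eqxx !orbT.
    rewrite !inE => /or4P[/eqP e0 | /eqP e0 | | ] //.
    - by move: e1; rewrite e0.
    - by move: e1; rewrite e0.
    - by rewrite /F4_gen => ->.
    by rewrite /F4_gen orbC => ->.
  have [i [j [lti ltj gE]]] := two_generator_stabilizer (oct_aut_hom Ag)
    (oct_aut_one Ag) (F4g _ g0) (F4g _ g1).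
  exists i, j; split=> //; apply/permP=> x; rewrite -[x]boctK permM !permX.
  have iterE n (s : {perm octonion 'F_2}) h u : (forall u, s (octb u) = octb (h u)) ->
    iter n s (octb u) = octb (iter n h u).
    by move=> sE; elim: n => //= n ->; rewrite sE.
  rewrite (iterE _ _ lin_d) // (iterE _ _ lin_f) // -[RHS]/(octb _).
  by have /(congr1 octb) := gE (boct x); rewrite /= !boctK.
split=> //; exists (oct_perm d), (oct_perm f), (oct_perm t), (oct_perm w).
by split.
Qed.
End OctonionGroup.

(** * The field of nine elements *)

(* The pair (a, b) stands for a + b i, where i^2 = -1 and 3 = 0. *)
Definition gauss : Type := (nat * nat)%type.
Definition gadd (a b : gauss) : gauss := ((a.1 + b.1) %% 3, (a.2 + b.2) %% 3)%N.
Definition gmul (a b : gauss) : gauss :=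
  ((a.1 * b.1 + 2 * (a.2 * b.2)) %% 3, (a.1 * b.2 + a.2 * b.1) %% 3)%N.
Definition gconj (a : gauss) : gauss := (a.1, (2 * a.2) %% 3)%N.
Definition gopp (a : gauss) : gauss := ((2 * a.1) %% 3, (2 * a.2) %% 3)%N.
Definition gauss9 : seq gauss := [seq (a, b) | a <- iota 0 3, b <- iota 0 3].

Section NineElementField.
Local Open Scope ring_scope.
Variables (K : fieldType) (theta : {rmorphism K -> K}).
Hypotheses (char3 : 3%:R = 0 :> K) (thetaE : forall x, theta x = x ^+ 3).
Hypotheses (thetaK : involutive theta) (theta_neq : exists x, theta x != x).

Lemma two_neq0 : 2%:R != 0 :> K.
Proof.
apply: contra (oner_neq0 K) => /eqP e2; apply/eqP.
have -> : 1 = 3%:R - 2%:R :> K by ring.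
by rewrite char3 e2 subr0.
Qed.

Lemma addrr_opp (x : K) : x + x = - x.
Proof.
have : 3%:R * x = 0 by rewrite char3 mul0r.
by move=> e; apply/eqP; rewrite -subr_eq0 -e; apply/eqP; ring.
Qed.

Lemma theta_fixed (x : K) : theta x = x -> x \in [:: 0; 1; -1].
Proof.
move/eqP; rewrite thetaE -subr_eq0 => /eqP e.
have /eqP : x * ((x - 1) * (x + 1)) = 0 by rewrite -e; ring.
by rewrite !mulf_eq0 subr_eq0 addr_eq0 !inE.
Qed.

(** A nonzero t = x - [theta] x is negated by [theta], so t^2 lies in {0, 1, -1}. If t^2 were 1, t
    would be fixed as well as negated, which is impossible as 2 is invertible. *)
Lemma sqrt_minus_one : exists i : K, i ^+ 2 = -1 /\ theta i = - i.
Proof.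
have [x x_neq] := theta_neq; pose t := x - theta x.
have t_opp : theta t = - t by rewrite rmorphB thetaK opprB.
have t0 : t != 0 by rewrite subr_eq0 eq_sym.
exists t; split=> //.
have : theta (t ^+ 2) = t ^+ 2 by rewrite rmorphXn t_opp /= sqrrN.
move/theta_fixed; rewrite !inE sqrf_eq0 (negPf t0) /= => /orP[|/eqP //].
rewrite sqrf_eq1 => t1.
have : theta t = t by case/orP: t1 => /eqP->; rewrite ?rmorphN rmorph1.
move/eqP; rewrite t_opp -subr_eq0 -opprD oppr_eq0 -mulr2n -mulr_natl.
by rewrite mulf_eq0 (negPf two_neq0) (negPf t0).
Qed.

Variable i : K.
Hypotheses (i_sq : i ^+ 2 = -1) (theta_i : theta i = - i).

Definition gauss_val (a : gauss) : K := a.1%:R + a.2%:R * i.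

Lemma natr_mod3 n : (n %% 3)%:R = n%:R :> K.
Proof. by rewrite {2}(divn_eq n 3) natrD natrM char3 mulr0 add0r. Qed.

Lemma natr2M n : (2 * n)%:R = - n%:R :> K.
Proof. by rewrite mul2n -addnn natrD addrr_opp. Qed.

Lemma toKD a b : gauss_val (gadd a b) = gauss_val a + gauss_val b.
Proof. by rewrite /gauss_val /= !natr_mod3 !natrD; ring. Qed.

Lemma toKM a b : gauss_val (gmul a b) = gauss_val a * gauss_val b.
Proof.
rewrite /gauss_val /= !natr_mod3 2!natrD natr2M !natrM -[- _]mulN1r -i_sq; ring.
Qed.

Lemma toK_opp a : gauss_val (gopp a) = - gauss_val a.
Proof.
by rewrite /gauss_val /= !natr_mod3 !natr2M; ring.
Qed.

Lemma toK_conj a : gauss_val (gconj a) = theta (gauss_val a).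
Proof.
by rewrite /gauss_val /= natr_mod3 natr2M rmorphD rmorphM !rmorph_nat theta_i; ring.
Qed.

Lemma prime_element (x : K) : theta x = x -> exists2 a, (a < 3)%N & x = a%:R.
Proof.
move/theta_fixed; rewrite !inE => /or3P[] /eqP->; [by exists 0%N | by exists 1%N|].
by exists 2%N; rewrite // -addrr_opp.
Qed.

(** For x = a + b i, trace and difference give x + [theta] x = 2a = -a and (x - [theta] x) i = 2b
    i^2 = b; both lie in the prime field. *)
Lemma toK_surj x : exists2 a, a \in gauss9 & x = gauss_val a.
Proof.
have i0 : i != 0 by rewrite -sqrf_eq0 i_sq oppr_eq0 oner_eq0.
have [a lta ea] : exists2 a, (a < 3)%N & - (x + theta x) = a%:R.
  by apply: prime_element; rewrite rmorphN rmorphD thetaK addrC.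
have [b ltb eb] : exists2 b, (b < 3)%N & (x - theta x) * i = b%:R.
  apply: prime_element; rewrite rmorphM rmorphB /= thetaK theta_i; ring.
exists (a, b).
  by rewrite /gauss9; apply/allpairsP; exists (a, b); rewrite !mem_iota.
rewrite /gauss_val /= -ea -eb -mulrA -expr2 i_sq mulrN1 opprB.
have -> : - (x + theta x) + (theta x - x) = - (x + x) by ring.
by rewrite addrr_opp opprK.
Qed.

Lemma toK_eq0 a : a \in gauss9 -> gauss_val a = 0 -> a = (0, 0)%N.
Proof.
have i0 : i != 0 by rewrite -sqrf_eq0 i_sq oppr_eq0 oner_eq0.
have n0 n : (n < 3)%N -> n%:R = 0 :> K -> n = 0%N.
  case: n => [|[|[|//]]] // _ /eqP; first by rewrite oner_eq0.
  by rewrite (negPf two_neq0).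
case: a => a b /allpairsP[[a' b'] [+ + [-> ->]]]; rewrite !mem_iota => /= lta ltb e.
have e' : a'%:R - b'%:R * i = 0.
  have := congr1 theta e.
  by rewrite /gauss_val /= rmorph0 rmorphD rmorphM !rmorph_nat theta_i mulrN.
rewrite /gauss_val /= in e.
have ea : 2%:R * a'%:R = 0 :> K.
  rewrite -[RHS]addr0 -{1}e -e'; ring.
have a0 : a'%:R = 0 :> K.
  by move/eqP: ea; rewrite mulf_eq0 (negPf two_neq0) => /eqP.
rewrite a0 add0r in e; move/eqP: e; rewrite mulf_eq0 (negPf i0) orbF.
by move/eqP/n0-> => //; rewrite (n0 a').
Qed.

End NineElementField.

(** * The Hermitian unital *)

Section HyperbolicBasis.
Local Open Scope ring_scope.
Variables (K : finFieldType) (theta : {rmorphism K -> K}).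
Hypotheses (char3 : 3%:R = 0 :> K) (thetaE : forall x, theta x = x ^+ 3).
Hypotheses (thetaK : involutive theta) (theta_neq : exists x, theta x != x).
Variable h : {hermitian 'rV[K]_3 for false & theta}.
Hypothesis nondeg_h : nondegenerate h.

Lemma sformC u v : h u v = theta (h v u).
Proof. by rewrite hermC expr0 mul1r. Qed.
Lemma sformDl u v w : h (u + v) w = h u w + h v w. Proof. exact: linearDl. Qed.
Lemma sformDr u v w : h w (u + v) = h w u + h w v. Proof. exact: linearDr. Qed.
Lemma sformZl a u v : h (a *: u) v = a * h u v. Proof. exact: linearZl_LR. Qed.
Lemma sformZr a u v : h u (a *: v) = theta a * h u v.
Proof. exact: linearZr_LR. Qed.
Lemma sformNl u v : h (- u) v = - h u v. Proof. exact: linearNl. Qed.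
Lemma sform0l v : h 0 v = 0. Proof. exact: linear0l. Qed.
Lemma sform0r v : h v 0 = 0. Proof. exact: linear0r. Qed.
Definition sformE := (sformDl, sformDr, sformZl, sformZr, sformNl).

Lemma sform_diag v : h v v \in [:: 0; 1; -1].
Proof. by apply: (theta_fixed thetaE); rewrite -sformC. Qed.

Lemma nondegP v : (forall w, h v w = 0) -> v = 0.
Proof.
move=> hv; apply/eqP; rewrite -memv0 -(eqP nondeg_h).
by apply/mem_orthovP=> w _; apply: hv.
Qed.

Lemma nondeg_ex v : v != 0 -> exists w, h v w != 0.
Proof.
move=> v0; case: (pickP (fun w => h v w != 0)) => [w hw | hw]; first by exists w.
by case/eqP: v0; apply: nondegP => w; have /eqP := hw w.
Qed.

(** The norm of 1 + i is 2 = -1. *)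
Lemma norm_surj a : a \in [:: 1; -1] -> exists c, c * theta c = a.
Proof.
have [i [i2 ti]] := sqrt_minus_one char3 thetaE thetaK theta_neq.
rewrite !inE => /orP[] /eqP->; first by exists 1; rewrite rmorph1 mulr1.
exists (1 + i); rewrite rmorphD rmorph1 ti.
have -> : (1 + i) * (1 - i) = 1 - i ^+ 2 by ring.
by rewrite i2 opprK (addrr_opp char3).
Qed.

Lemma ex_notin (V : {vspace 'rV[K]_3}) : (\dim V < 3)%N -> exists x, x \notin V.
Proof.
move=> dV; have /subvPn[x _ xV] : ~~ ({:'rV[K]_3} <= V)%VS.
  apply: contraL dV => /dimvS; rewrite dimvf /dim /= mul1n -leqNgt.
  by apply: leq_trans.
by exists x.
Qed.

(** For orthogonal anisotropic v and w, surjectivity of the norm gives c with h(v, v) + c [theta](c)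
    h(w, w) = 0; then v + c w is isotropic. *)
Lemma isotropic_ex : exists2 v, v != 0 & h v v = 0.
Proof.
have [|v v0] := @ex_notin 0; first by rewrite dimv0.
rewrite memv0 in v0; case: (eqVneq (h v v) 0) => [|hv]; first by exists v.
have [|x xv] := @ex_notin <[v]>; first by rewrite dim_vline v0.
have [w w0 hwv] : exists2 w, w != 0 & h w v = 0.
  exists (x - (h x v / h v v) *: v); last by rewrite !sformE divfK ?subrr.
  by apply: contra xv; rewrite subr_eq0 => /eqP->; rewrite memvZ ?memv_line.
case: (eqVneq (h w w) 0) => [|hw]; first by exists w.
have [|c ec] := @norm_surj (- (h v v / h w w)).
  move: (sform_diag v) (sform_diag w); rewrite !inE (negPf hv) (negPf hw) /=.
  by do 2!case/orP=> /eqP->; rewrite ?invrN invr1 ?mulr1 ?mulrN1 ?opprK eqxx ?orbT.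
exists (v + c *: w).
  apply: contra hv => /eqP e; have := sform0l v; rewrite -e !sformE hwv mulr0 addr0.
  by move->.
rewrite !sformE hwv (sformC v w) hwv rmorph0 !mulr0 addr0 add0r.
by rewrite mulrA ec mulNr divfK ?subrr.
Qed.

Definition hyperbolic_basis (e0 e1 e2 : 'rV[K]_3) : Prop :=
  [/\ h e0 e0 = 0, h e2 e2 = 0 & h e0 e2 = 1] /\
  [/\ h e1 e1 = 1, h e1 e0 = 0, h e1 e2 = 0
    & forall v, v = h v e2 *: e0 + h v e1 *: e1 + h v e0 *: e2].

Lemma hyperbolic_basis_ex : exists e0 e1 e2, hyperbolic_basis e0 e1 e2.
Proof.
have [e0 e0_neq h00] := isotropic_ex.
have [w1 h01] : exists w1, h e0 w1 = 1.
  have [w hw] := nondeg_ex e0_neq.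
  by exists (theta (h e0 w)^-1 *: w); rewrite sformZr thetaK mulVf.
have h10 : h w1 e0 = 1 by rewrite sformC h01 rmorph1.
have [e2 h02 h22] : exists2 e2, h e0 e2 = 1 & h e2 e2 = 0.
  (* With a = [h w1 w1], fixed by [theta], the new vector has norm a + a + a = 0. *)
  exists (w1 + h w1 w1 *: e0); first by rewrite !sformE h00 h01 mulr0 addr0.
  rewrite !sformE h00 h01 h10 -sformC !mulr0 !mulr1 addr0.
  by rewrite (addrr_opp char3) addNr.
have h20 : h e2 e0 = 1 by rewrite sformC h02 rmorph1.
have [|x xV] := @ex_notin (<[e2]> + <[e0]>).
  by apply: leq_ltn_trans (dimv_add_leqif _ _) _; rewrite !dim_vline; do 2!case: eqP.
have [e [eV he0 he2]] : exists e, [/\ e \notin (<[e2]> + <[e0]>)%VS,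
    h e e0 = 0 & h e e2 = 0].
  exists (x - (h x e0 *: e2 + h x e2 *: e0)); split.
  - apply: contra xV => /memvD-/(_ (h x e0 *: e2 + h x e2 *: e0)).
    by rewrite subrK; apply; rewrite memv_add ?memvZ ?memv_line.
  - by rewrite !sformE h20 h00 mulr1 mulr0 addr0 subrr.
  by rewrite !sformE h22 h02 mulr1 mulr0 add0r subrr.
have bas : basis_of {:'rV[K]_3} [tuple e; e0; e2].
  rewrite basisEfree subvf dimvf /dim /= andbT !free_cons nil_free andbT.
  rewrite !span_cons span_nil addv0 addvC eV /=; apply/andP; split.
    apply/vlineP=> -[k e0k]; move: h02; rewrite e0k sformZl h22 mulr0.
    by move/eqP; rewrite eq_sym oner_eq0.
  rewrite memv0; apply/eqP=> e20; move: h02; rewrite e20 sform0r.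
  by move/eqP; rewrite eq_sym oner_eq0.
have span v : exists a b c, v = b *: e0 + a *: e + c *: e2.
  have := coord_basis bas (memvf v); rewrite !big_ord_recl big_ord0 addr0 /=.
  by move=> ev; do 3!eexists; rewrite [LHS]ev addrA [X in X + _]addrC.
(* Otherwise [e], already orthogonal to [e0] and [e2], would be in the radical. *)
have hee : h e e != 0.
  apply: contra eV => /eqP hee; rewrite (_ : e = 0) ?mem0v //.
  apply: nondegP => v; have [a [b [c ->]]] := span v.
  by rewrite !sformE he0 he2 hee !mulr0 !addr0.
have [c ec] : exists c, c * theta c = h e e.
  by apply: norm_surj; move: (sform_diag e); rewrite inE (negPf hee).
have c0 : c != 0 by apply: contra hee => /eqP c0; rewrite -ec c0 mul0r.
exists e0, (c^-1 *: e), e2.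
have h1 : h (c^-1 *: e) (c^-1 *: e) = 1.
  by rewrite !sformE -ec fmorphV; field; rewrite c0 fmorph_eq0 c0.
have h10' : h (c^-1 *: e) e0 = 0 by rewrite sformZl he0 mulr0.
have h12' : h (c^-1 *: e) e2 = 0 by rewrite sformZl he2 mulr0.
do 2!split=> //; move=> v.
have [a [b [d]]] := span v.
have -> : a *: e = (a * c) *: (c^-1 *: e) by rewrite scalerA mulfK.
move: (a * c) (c^-1 *: e) h1 h10' h12' => y e1 h11 h10' h12' ->.
have h01' : h e0 e1 = 0 by rewrite sformC h10' rmorph0.
have h21' : h e2 e1 = 0 by rewrite sformC h12' rmorph0.
rewrite !sformE h00 h02 h20 h22 h11 h10' h12' h01' h21'.
by rewrite !mulr0 !mulr1 !add0r !addr0.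
Qed.

End HyperbolicBasis.

(** * Semisimilitudes and the collineations they induce *)

Section SemiSimilitudes.
Local Open Scope ring_scope.
Variables (K : finFieldType) (theta : {rmorphism K -> K}).
Variable h : {hermitian 'rV[K]_3 for false & theta}.
Hypothesis nondeg_h : nondegenerate h.

Lemma finField_morph_surj (sigma : {rmorphism K -> K}) a :
  exists b, sigma b = a.
Proof.
have [g _ gK] := injF_bij (fmorph_inj sigma).
by exists (g a); rewrite gK.
Qed.

Lemma semilinear0 (sigma : {rmorphism K -> K}) (phi : 'rV[K]_3 -> 'rV[K]_3) :
  linear_for (sigma \; *:%R) phi -> phi 0 = 0.
Proof.
move=> phiL; apply: (@addrI _ (phi 0)); rewrite addr0.
by have := phiL 1 0 0; rewrite /= rmorph1 !scale1r addr0.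
Qed.

Lemma semilinearZ (sigma : {rmorphism K -> K}) (phi : 'rV[K]_3 -> 'rV[K]_3) :
  linear_for (sigma \; *:%R) phi -> forall a v, phi (a *: v) = sigma a *: phi v.
Proof.
by move=> phiL a v; have := phiL a v 0; rewrite !addr0 (semilinear0 phiL) addr0.
Qed.

Lemma semilinearD (sigma : {rmorphism K -> K}) (phi : 'rV[K]_3 -> 'rV[K]_3) :
  linear_for (sigma \; *:%R) phi -> {morph phi : u v / u + v}.
Proof. by move=> phiL u v; have := phiL 1 u v; rewrite /= rmorph1 !scale1r. Qed.

(** A vector in the kernel is orthogonal to everything. *)
Lemma semisimilitude_inj phi : semisimilitude h phi -> injective phi.
Proof.
move=> [sigma [phiL [c c0 hphi]]] u v euv; apply/eqP; rewrite -subr_eq0.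
have e0 : phi (u - v) = 0.
  apply: (@addIr _ (phi v)); rewrite -(semilinearD phiL) subrK add0r //.
apply/eqP/(nondegP nondeg_h) => w; apply: (fmorph_inj sigma); rewrite rmorph0.
by apply: (mulfI c0); rewrite -hphi e0 sform0l mulr0.
Qed.

Lemma GammaU_of phi : semisimilitude h phi -> exists2 p, p \in GammaU h & p =1 phi.
Proof.
move=> simphi; exists (perm (semisimilitude_inj simphi)); last exact: permE.
rewrite inE; apply/asboolP; move: simphi => [sigma [phiL [c c0 hphi]]].
exists sigma; split=> [a u v|]; first by rewrite !permE phiL.
by exists c => // x y; rewrite !permE hphi.
Qed.

Definition induces (p : {perm 'rV[K]_3}) (s : {perm pg_point K}) : Prop :=
  forall P x, (p x \in val (s P)) = (x \in val P).

Lemma line_of_point (P : pg_point K) v : v != 0 -> v \in val P -> val P = <[v]>%VS.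
Proof.
move=> v0 vP; apply/esym/eqP; rewrite eqEdim -memvE vP /= dim_vline v0.
by rewrite (eqP (valP P)).
Qed.

Lemma point_vector (P : pg_point K) : exists2 v, v != 0 & val P = <[v]>%VS.
Proof.
have P0 : val P != 0%VS by rewrite -dimv_eq0 (eqP (valP P)).
exists (vpick (val P)); first by rewrite vpick0.
by apply: line_of_point; rewrite ?vpick0 ?memv_pick.
Qed.

Fact point_of_proof (v : 'rV[K]_3) : v != 0 -> \dim <[v]>%VS == 1%N.
Proof. by rewrite dim_vline => ->. Qed.
Definition point_of v (v0 : v != 0) : pg_point K := Sub <[v]>%VS (point_of_proof v0).

Lemma GammaU0 p : p \in GammaU h -> p 0 = 0.
Proof. by rewrite inE => /asboolP[sigma [/semilinear0]]. Qed.

Lemma GammaU_neq0 p v : p \in GammaU h -> v != 0 -> p v != 0.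
Proof. by move=> Gp; rewrite -{2}(GammaU0 Gp) (inj_eq perm_inj). Qed.

Lemma induces_line p s (P : pg_point K) v : p \in GammaU h -> induces p s ->
  v != 0 -> val P = <[v]>%VS -> val (s P) = <[p v]>%VS.
Proof.
move=> Gp ps v0 Pv; apply: line_of_point; first exact: GammaU_neq0.
by rewrite ps Pv memv_line.
Qed.

Lemma PGammaU_of p : p \in GammaU h -> exists2 s, s \in PGammaU h & induces p s.
Proof.
move=> Gp; have /asboolP[sigma [pL _]] : `[< semisimilitude h p >] by rewrite inE in Gp.
have P0 (P : pg_point K) : vpick (val P) != 0.
  by rewrite vpick0 -dimv_eq0 (eqP (valP P)).
pose f P := point_of (GammaU_neq0 Gp (P0 P)).
have valE (P : pg_point K) : val P = <[vpick (val P)]>%VS.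
  by apply: line_of_point; rewrite ?memv_pick.
have fE P x : (p x \in val (f P)) = (x \in val P).
  rewrite (valE P) /=; apply/vlineP/vlineP=> -[k].
    have [k' <-] := finField_morph_surj sigma k; rewrite -(semilinearZ pL).
    by move/perm_inj=> ->; exists k'.
  by move=> ->; exists (sigma k); rewrite (semilinearZ pL).
have finj : injective f.
  move=> P Q fPQ; apply: val_inj; apply/vspaceP=> x.
  by rewrite -(fE P x) -(fE Q x) fPQ.
exists (perm finj) => [|P x]; last by rewrite permE fE.
by rewrite inE; apply/asboolP; exists p => // P x; rewrite permE fE.
Qed.

Lemma PGammaUP s : s \in PGammaU h -> exists2 p, p \in GammaU h & induces p s.
Proof. by rewrite inE => /asboolP[p Gp ps]; exists p. Qed.

Lemma unital_line (P : pg_point K) v : v != 0 -> val P = <[v]>%VS ->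
  (P \in unital_points h) = (h v v == 0).
Proof.
move=> v0 Pv; rewrite inE; apply/asboolP/eqP=> [hP | hv x y].
  by apply: hP; rewrite Pv memv_line.
rewrite Pv => /vlineP[a ->] /vlineP[b ->].
by rewrite sformZl sformZr hv !mulr0.
Qed.

Lemma acts_unital : [acts PGammaU h, on unital_points h | 'P].
Proof.
apply/subsetP=> s Gs; rewrite in_set in_setT in_set /=; apply/subsetP=> P UP.
rewrite in_set; move: UP.
have [p Gp ps] := PGammaUP Gs; have [v v0 Pv] := point_vector P.
have /asboolP[sigma [_ [c c0 hp]]] : `[< semisimilitude h p >] by rewrite inE in Gp.
rewrite (unital_line v0 Pv) (@unital_line _ (p v)) ?GammaU_neq0 //.
  by rewrite hp => /eqP->; rewrite rmorph0 mulr0.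
exact: induces_line Pv.
Qed.

End SemiSimilitudes.

(** * The unital and the four maps in computable coordinates *)

Lemma mod3_gauss9 a b : (a %% 3, b %% 3)%N \in gauss9.
Proof.
by apply/allpairsP; exists (a %% 3, b %% 3)%N; rewrite !mem_iota !ltn_pmod.
Qed.

Lemma gadd9 a b : gadd a b \in gauss9. Proof. exact: mod3_gauss9. Qed.
Lemma gmul9 a b : gmul a b \in gauss9. Proof. exact: mod3_gauss9. Qed.

Definition gtriple : Type := (gauss * gauss * gauss)%type.
Definition gscale (m : gauss) (u : gtriple) : gtriple :=
  (gmul m u.1.1, gmul m u.1.2, gmul m u.2).
Definition gform (u v : gtriple) : gauss :=
  gadd (gadd (gmul u.1.1 (gconj v.2)) (gmul u.1.2 (gconj v.1.2)))
       (gmul u.2 (gconj v.1.1)).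
(** Isotropic vectors scaled so that the last nonzero coordinate is 1; their order fixes the
    numbering behind the tables. *)
Definition unital_list : seq gtriple :=
  ((1, 0), (0, 0), (0, 0))%N ::
  [seq u <- [seq (x, y, (1, 0)%N) | y <- gauss9, x <- gauss9]
     | gform u u == (0, 0)%N].
Definition unital_triple (k : nat) : gtriple :=
  nth ((0, 0), (0, 0), (0, 0))%N unital_list k.

Definition zeta : gauss := (1, 1)%N.
Definition gmap_d (u : gtriple) : gtriple :=
  (gmul zeta u.1.1, u.1.2, gmul (gopp zeta) u.2).
Definition gmap_f (u : gtriple) : gtriple :=
  (gconj u.1.1, gconj u.1.2, gconj u.2).
Definition gmap_t (u : gtriple) : gtriple :=
  (gadd (gadd u.1.1 (gopp u.1.2)) u.2, gadd u.1.2 u.2, u.2).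
Definition gmap_w (u : gtriple) : gtriple := (u.2, u.1.2, u.1.1).

Definition maps_by_table (g : gtriple -> gtriple) (tab : seq nat) : bool :=
  all (fun k => has (fun m => (m != (0, 0)%N) &&
    (g (unital_triple k) == gscale m (unital_triple (nth 0%N tab k)))) gauss9)
  (iota 0 28).

Lemma table_d : maps_by_table gmap_d tab_d. Proof. by vm_compute. Qed.
Lemma table_f : maps_by_table gmap_f tab_f. Proof. by vm_compute. Qed.
Lemma table_t : maps_by_table gmap_t tab_t. Proof. by vm_compute. Qed.
Lemma table_w : maps_by_table gmap_w tab_w. Proof. by vm_compute. Qed.

Lemma unital_triple_inj : all (fun k => all (fun l => all (fun m =>
    (unital_triple k == gscale m (unital_triple l)) ==> (k == l)) gauss9)
  (iota 0 28)) (iota 0 28).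
Proof. by vm_compute. Qed.

Lemma gauss_sub_eq0 : all (fun a => all (fun b => let c := gadd a (gopp b) in
  (c \in gauss9) && ((c == (0, 0)%N) ==> (a == b))) gauss9) gauss9.
Proof. by vm_compute. Qed.

Lemma zeta_powers : all (fun a => (a == (0, 0)%N) ||
  has (fun n => iter n (gmul zeta) (1, 0)%N == a) (iota 0 8)) gauss9.
Proof. by vm_compute. Qed.

Lemma unital_list_ok : all (fun u => [&& u.1.1 \in gauss9, u.1.2 \in gauss9,
  u.2 \in gauss9, gform u u == (0, 0)%N & u != ((0, 0), (0, 0), (0, 0))%N])
  unital_list.
Proof. by vm_compute. Qed.

Lemma size_unital_list : size unital_list = 28.
Proof. by vm_compute. Qed.

(** * The permutation group induced on the unital *)

Section UnitalCoordinates.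
Local Open Scope ring_scope.
Variables (K : finFieldType) (theta : {rmorphism K -> K}).
Hypotheses (char3 : 3%:R = 0 :> K) (thetaE : forall x, theta x = x ^+ 3).
Hypotheses (thetaK : involutive theta).
Variable i : K.
Hypotheses (i_sq : i ^+ 2 = -1) (theta_i : theta i = - i).
Variable h : {hermitian 'rV[K]_3 for false & theta}.
Hypothesis nondeg_h : nondegenerate h.
Variables e0 e1 e2 : 'rV[K]_3.
Hypothesis hb : hyperbolic_basis h e0 e1 e2.

Local Notation toK := (gauss_val i).

Definition vec (t : K * K * K) : 'rV[K]_3 := t.1.1 *: e0 + t.1.2 *: e1 + t.2 *: e2.
Definition coords (v : 'rV[K]_3) : K * K * K := (h v e2, h v e1, h v e0).

Lemma coordsK : cancel coords vec.
Proof. by case: hb => _ [_ _ _ vE] v; rewrite /vec -vE. Qed.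

Lemma vecK : cancel vec coords.
Proof.
case: hb => -[h00 h22 h02] [h11 h10 h12 _] [[x y] z].
have h20 : h e2 e0 = 1 by rewrite sformC h02 rmorph1.
have h01 : h e0 e1 = 0 by rewrite sformC h10 rmorph0.
have h21 : h e2 e1 = 0 by rewrite sformC h12 rmorph0.
rewrite /coords /vec !sformE h00 h22 h02 h11 h10 h12 h20 h01 h21.
by rewrite !mulr0 !mulr1 !addr0 !add0r.
Qed.

Lemma vec_form t u : h (vec t) (vec u) =
  t.1.1 * theta u.2 + t.1.2 * theta u.1.2 + t.2 * theta u.1.1.
Proof.
case: hb => -[h00 h22 h02] [h11 h10 h12 _].
have h20 : h e2 e0 = 1 by rewrite sformC h02 rmorph1.
have h01 : h e0 e1 = 0 by rewrite sformC h10 rmorph0.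
have h21 : h e2 e1 = 0 by rewrite sformC h12 rmorph0.
rewrite /vec !sformE h00 h22 h02 h11 h10 h12 h20 h01 h21.
by rewrite !mulr0 !mulr1 !addr0 !add0r; ring.
Qed.

Lemma vecZ a t : a *: vec t = vec (a * t.1.1, a * t.1.2, a * t.2).
Proof. by rewrite /vec !scalerDr !scalerA. Qed.

Lemma vecD t u : vec t + vec u = vec (t.1.1 + u.1.1, t.1.2 + u.1.2, t.2 + u.2).
Proof. by rewrite /vec /= !scalerDl addrACA; congr (_ + _); rewrite addrACA. Qed.

Lemma vec0 : vec (0, 0, 0) = 0.
Proof. by rewrite /vec !scale0r !addr0. Qed.

Lemma vec_eq0 t : (vec t == 0) = (t == (0, 0, 0)).
Proof. by rewrite -vec0 (can_eq vecK). Qed.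

Lemma coord_semisimilitude (sigma : {rmorphism K -> K}) (g : K * K * K -> K * K * K) :
  (forall a t u, g (a * t.1.1 + u.1.1, a * t.1.2 + u.1.2, a * t.2 + u.2) =
     (sigma a * (g t).1.1 + (g u).1.1, sigma a * (g t).1.2 + (g u).1.2,
      sigma a * (g t).2 + (g u).2)) ->
  (forall t u, h (vec (g t)) (vec (g u)) = sigma (h (vec t) (vec u))) ->
  semisimilitude h (vec \o g \o coords).
Proof.
move=> gL gh; exists sigma; split=> [a u v|].
  rewrite -[u]coordsK -[v]coordsK /= vecZ vecD !vecK gL.
  by rewrite vecZ vecD.
exists 1; rewrite ?oner_neq0 // => x y.
by rewrite mul1r -{2}[x]coordsK -{2}[y]coordsK gh.
Qed.

Definition map_d (t : K * K * K) : K * K * K :=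
  ((1 + i) * t.1.1, t.1.2, - (1 + i) * t.2).
Definition map_f (t : K * K * K) : K * K * K :=
  (theta t.1.1, theta t.1.2, theta t.2).
Definition map_t (t : K * K * K) : K * K * K :=
  (t.1.1 - t.1.2 + t.2, t.1.2 + t.2, t.2).
Definition map_w (t : K * K * K) : K * K * K := (t.2, t.1.2, t.1.1).

(** This makes [map_d] an isometry: its outer coefficients are paired by the form. *)
Lemma zeta_unit : - ((1 + i) * theta (1 + i)) = 1.
Proof.
rewrite rmorphD rmorph1 theta_i.
have -> : (1 + i) * (1 - i) = 1 - i ^+ 2 by ring.
by rewrite i_sq opprK (addrr_opp char3) opprK.
Qed.

Lemma map_d_sim : semisimilitude h (vec \o map_d \o coords).
Proof.
apply: (@coord_semisimilitude idfun) => [a t u | t u].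
  by rewrite /map_d /=; congr (_, _, _); ring.
rewrite !vec_form /= !rmorphM !rmorphN.
transitivity (- ((1 + i) * theta (1 + i)) * (t.1.1 * theta u.2 + t.2 * theta u.1.1)
   + t.1.2 * theta u.1.2); first by ring.
by rewrite zeta_unit; ring.
Qed.

Lemma map_f_sim : semisimilitude h (vec \o map_f \o coords).
Proof.
apply: (@coord_semisimilitude theta) => [a t u | t u].
  by rewrite /map_f /= !rmorphD !rmorphM.
by rewrite !vec_form /= !rmorphD !rmorphM.
Qed.

Lemma map_t_sim : semisimilitude h (vec \o map_t \o coords).
Proof.
apply: (@coord_semisimilitude idfun) => [a t u | t u].
  by rewrite /map_t /=; congr (_, _, _); ring.
rewrite !vec_form /= !rmorphD !rmorphN.
transitivity (t.1.1 * theta u.2 + t.1.2 * theta u.1.2 + t.2 * theta u.1.1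
  + 3%:R * (t.2 * theta u.2)); first by ring.
by rewrite char3 mul0r addr0.
Qed.

Lemma map_w_sim : semisimilitude h (vec \o map_w \o coords).
Proof.
apply: (@coord_semisimilitude idfun) => [a t u | t u] //.
by rewrite !vec_form /=; ring.
Qed.

Definition gtoK (u : gtriple) : K * K * K := (toK u.1.1, toK u.1.2, toK u.2).

Lemma toK_zeta : toK zeta = 1 + i.
Proof. by rewrite /gauss_val mul1r. Qed.

Lemma gtoK_d u : map_d (gtoK u) = gtoK (gmap_d u).
Proof. by rewrite /gtoK /= !(toKM, toK_opp) // toK_zeta. Qed.
Lemma gtoK_f u : map_f (gtoK u) = gtoK (gmap_f u).
Proof. by rewrite /gtoK /= !(toK_conj char3 theta_i). Qed.
Lemma gtoK_t u : map_t (gtoK u) = gtoK (gmap_t u).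
Proof. by rewrite /gtoK /= !(toKD, toK_opp). Qed.
Lemma gtoK_w u : map_w (gtoK u) = gtoK (gmap_w u).
Proof. by []. Qed.

Lemma gtoK_scale m u : vec (gtoK (gscale m u)) = toK m *: vec (gtoK u).
Proof. by rewrite vecZ /gtoK /= !toKM. Qed.

Lemma gtoK_form u v : h (vec (gtoK u)) (vec (gtoK v)) = toK (gform u v).
Proof. by rewrite vec_form /gform !(toKD, toKM, toK_conj char3 theta_i). Qed.

Lemma toK_inj : {in gauss9 &, injective toK}.
Proof.
move=> a b a9 b9 e; have /andP[c9] := allP (allP gauss_sub_eq0 a a9) b b9.
move/implyP=> ab; apply/eqP/ab/eqP; apply: (toK_eq0 char3 i_sq theta_i c9).
by rewrite toKD // toK_opp // e subrr.
Qed.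

Lemma toK_neq0 m : m \in gauss9 -> m != (0, 0)%N -> toK m != 0.
Proof.
by move=> m9; apply: contra => /eqP e; apply/eqP/(toK_eq0 char3 i_sq theta_i m9).
Qed.

Lemma unital_tripleP (k : 'I_28) : let u := unital_triple k in
  [&& u.1.1 \in gauss9, u.1.2 \in gauss9, u.2 \in gauss9,
      gform u u == (0, 0)%N & u != ((0, 0), (0, 0), (0, 0))%N].
Proof.
by apply: (allP unital_list_ok); rewrite mem_nth // size_unital_list.
Qed.

Definition unital_vec (k : nat) : 'rV[K]_3 := vec (gtoK (unital_triple k)).

Lemma unital_vec_neq0 (k : 'I_28) : unital_vec k != 0.
Proof.
rewrite vec_eq0; have := unital_tripleP k.
case: (unital_triple k) => [[x y] z] /= /and5P[x9 y9 z9 _].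
apply: contra => /eqP[x0 y0 z0]; have eq0 := toK_eq0 char3 i_sq theta_i.
by rewrite (eq0 x) // (eq0 y) // (eq0 z).
Qed.

Definition unital_point (k : 'I_28) : pg_point K := point_of (unital_vec_neq0 k).

Lemma unital_point_inj : injective unital_point.
Proof.
move=> k l /(congr1 val) /= ekl.
have /vlineP[m em] : unital_vec k \in <[unital_vec l]>%VS.
  by rewrite -ekl memv_line.
have [a a9 ea] := toK_surj char3 thetaE thetaK i_sq theta_i m.
move: em; rewrite ea /unital_vec -gtoK_scale => /(can_inj vecK)[].
have e : (toK (unital_triple k).1.1 = toK (gmul a (unital_triple l).1.1)) ->
  toK (unital_triple k).1.2 = toK (gmul a (unital_triple l).1.2) ->
  toK (unital_triple k).2 = toK (gmul a (unital_triple l).2) ->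
  unital_triple k = gscale a (unital_triple l).
  move: (unital_tripleP k) (unital_tripleP l).
  move: (unital_triple k) (unital_triple l) => [[x y] z] [[x' y'] z'] /=.
  case/and5P=> x9 y9 z9 _ _ /and5P[x9' y9' z9' _ _].
  by move=> ex ey ez; congr (_, _, _); apply: toK_inj => //; apply: gmul9.
move=> ex ey ez; have {ex ey ez}e := e ex ey ez.
have := unital_triple_inj => /allP/(_ k); rewrite mem_iota ltn_ord => /(_ isT).
move/allP/(_ l); rewrite mem_iota ltn_ord => /(_ isT)/allP/(_ a a9).
by rewrite e eqxx => /eqP/val_inj.
Qed.

Lemma unital_points_image : unital_points h = unital_point @: setT.
Proof.
apply/setP=> P; apply/idP/imsetP=> [|[k _ ->]]; last first.
  rewrite (@unital_line _ _ _ _ (unital_vec k)) ?unital_vec_neq0 //.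
  rewrite gtoK_form; case/and5P: (unital_tripleP k) => _ _ _ /eqP-> _.
  by rewrite /gauss_val mul0r addr0.
have [v v0 Pv] := point_vector P; rewrite (unital_line h v0 Pv).
have line_eq u a : u \in unital_list -> a != 0 -> v = a *: vec (gtoK u) ->
    exists2 k : 'I_28, k \in setT & P = unital_point k.
  move=> uL a0 ev; have ltu : (index u unital_list < 28)%N.
    by rewrite -size_unital_list index_mem.
  exists (Ordinal ltu) => //; apply: val_inj; apply: line_of_point.
    exact: unital_vec_neq0.
  rewrite Pv /unital_vec /unital_triple /= nth_index // ev.
  by apply/vlineP; exists a^-1; rewrite scalerA mulVf // scale1r.
move: line_eq v0; rewrite -[v]coordsK vec_eq0 vec_form.
case: (coords v) => -[x y] z /= line_eq xyz0.
(* If z = 0, isotropy leaves y [theta](y) = 0, hence only (1 : 0 : 0); otherwise dividing by z gives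
   a listed affine point. *)
have [z0 | z0] := eqVneq z 0.
  rewrite z0 rmorph0 mulr0 add0r mul0r addr0 mulf_eq0 fmorph_eq0 orbb => /eqP y0.
  have x0 : x != 0 by apply: contra xyz0 => /eqP->; rewrite y0 z0.
  apply: (line_eq ((1, 0), (0, 0), (0, 0))%N x) => //.
  by rewrite vecZ /gtoK /gauss_val /= y0 z0 !mul0r !addr0 mulr1 mulr0.
have [a a9 ea] := toK_surj char3 thetaE thetaK i_sq theta_i (x / z).
have [b b9 eb] := toK_surj char3 thetaE thetaK i_sq theta_i (y / z).
pose u : gtriple := (a, b, (1, 0)%N).
have eu : vec (x, y, z) = z *: vec (gtoK u).
  rewrite vecZ /gtoK /= -ea -eb !mulrA ![z * _]mulrC !mulfK //.
  by rewrite /gauss_val mul0r addr0 mul1r.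
move=> iso; apply: (line_eq u z) => //; rewrite inE mem_filter; apply/orP; right.
apply/andP; split; last by apply/allpairsP; exists (b, a).
have : h (vec (gtoK u)) (vec (gtoK u)) = 0.
  have : h (z *: vec (gtoK u)) (z *: vec (gtoK u)) = 0.
    by rewrite -eu vec_form /=; apply/eqP.
  rewrite sformZl sformZr => /eqP; rewrite !mulf_eq0 fmorph_eq0 (negPf z0) /=.
  by move/eqP.
by rewrite gtoK_form => /(toK_eq0 char3 i_sq theta_i)->; rewrite ?gadd9.
Qed.

Lemma acts_unital_points : [acts PGammaU h, on unital_point @: setT | 'P].
Proof. by rewrite -unital_points_image; apply: acts_unital. Qed.

Definition unital_perm := index_perm (0 : 'I_28) unital_point_inj acts_unital_points.

Lemma unital_perm_realizes p s g (c : gtriple -> gtriple) tab :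
  p \in GammaU h -> p =1 vec \o g \o coords ->
  (forall u, g (gtoK u) = gtoK (c u)) ->
  s \in PGammaU h -> induces p s -> maps_by_table c tab -> all (gtn 28) tab ->
  realizes (unital_perm s) tab.
Proof.
move=> Gp pE gE Gs ps /allP tabk /allP tab28 k.
have lt28 : (nth 0%N tab k < 28)%N.
  have [/(mem_nth 0%N)/tab28 // | /(nth_default 0%N)-> //] := ltnP k (size tab).
suff -> : unital_perm s k = Ordinal lt28 by [].
apply: index_permP => //; apply: val_inj.
rewrite /= /aperm (induces_line Gp ps (unital_vec_neq0 k)) //=.
have /hasP[m m9 /andP[m0 /eqP cm]] := tabk k (ltac:(by rewrite mem_iota ltn_ord)).
rewrite pE /= vecK gE cm gtoK_scale; apply/esym/eqP.
rewrite eqEdim -memvE !dim_vline scaler_eq0 negb_or toK_neq0 //=.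
rewrite (unital_vec_neq0 (Ordinal lt28)) /= andbT.
apply/vlineP; exists (toK m)^-1.
by rewrite scalerA mulVf ?scale1r // toK_neq0.
Qed.

Lemma inducesM (p q : {perm 'rV[K]_3}) (s t : {perm pg_point K}) :
  induces p s -> induces q t -> induces (p * q)%g (s * t)%g.
Proof. by move=> ps qt P x; rewrite !permM qt ps. Qed.

Lemma inducesX (p : {perm 'rV[K]_3}) (s : {perm pg_point K}) n :
  induces p s -> induces (p ^+ n)%g (s ^+ n)%g.
Proof.
move=> ps; elim: n => [P x | n IHn]; first by rewrite !perm1.
by rewrite !expgS; apply: inducesM.
Qed.

Lemma induces_proportional p q s t b : p \in GammaU h -> q \in GammaU h ->
  induces p s -> induces q t -> b != 0 -> (forall v, p v = b *: q v) -> s = t.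
Proof.
move=> Gp Gq ps qt b0 pq; apply/permP=> P; apply: val_inj.
have [v v0 Pv] := point_vector P.
rewrite (induces_line Gp ps v0 Pv); apply/esym/line_of_point.
  exact: GammaU_neq0 Gp v0.
by rewrite pq memvZ // qt Pv memv_line.
Qed.

(** [sigma] fixes the prime field and sends i to a square root of -1, so to i or -i. *)
Lemma endomorphism_cases (sigma : {rmorphism K -> K}) :
  exists2 j, (j < 2)%N & forall x, sigma x = iter j theta x.
Proof.
have : (sigma i - i) * (sigma i + i) = 0.
  have : sigma i ^+ 2 = -1 by rewrite -rmorphXn i_sq rmorphN rmorph1.
  by move=> s2; rewrite -subr_sqr s2 i_sq subrr.
have E x : exists a b : nat, x = a%:R + b%:R * i.
  by have [[a b] _ ->] := toK_surj char3 thetaE thetaK i_sq theta_i x; exists a, b.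
move/eqP; rewrite mulf_eq0 subr_eq0 addr_eq0 => /orP[] /eqP si.
  exists 0%N => // x; have [a [b ->]] := E x.
  by rewrite /= rmorphD rmorphM !rmorph_nat si.
exists 1%N => // x; have [a [b ->]] := E x.
by rewrite /= !rmorphD !rmorphM !rmorph_nat si theta_i.
Qed.

Lemma zeta_power x : x != 0 -> exists2 n, (n < 8)%N & (1 + i) ^+ n = x.
Proof.
have [a a9 ->] := toK_surj char3 thetaE thetaK i_sq theta_i x => a0.
have /orP[/eqP a00 | /hasP[n]] := allP zeta_powers a a9.
  by rewrite a00 /gauss_val mul0r addr0 eqxx in a0.
rewrite mem_iota => /= ltn /eqP <-; exists n => //.
have tE m : (1 + i) ^+ m = toK (iter m (gmul zeta) (1, 0)%N).
  elim: m => [|m IHm]; first by rewrite /gauss_val mul0r addr0.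
  by rewrite exprS IHm /= toKM // toK_zeta.
exact: tE.
Qed.

Section TwoPointStabilizer.
Variables (p : {perm 'rV[K]_3}) (sigma : {rmorphism K -> K}) (c a d : K).
Hypotheses (pL : linear_for (sigma \; *:%R) p) (c_neq0 : c != 0).
Hypothesis (ph : forall x y, h (p x) (p y) = c * sigma (h x y)).
Hypotheses (p0 : p (vec (1, 0, 0)) = a *: vec (1, 0, 0)).
Hypotheses (p2 : p (vec (0, 0, 1)) = d *: vec (0, 0, 1)).

(** The middle basis vector is orthogonal to the two fixed points, so its line is preserved too.
    Comparing multipliers gives a [theta](d) = c = b [theta](b), and dividing by b normalizes the
    middle entry to 1. *)
Lemma diagonal_semisimilitude : exists b : K,
  [/\ b != 0, (a / b) * theta (d / b) = 1 & forall t,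
    p (vec t) = b *: vec (a / b * sigma t.1.1, sigma t.1.2, d / b * sigma t.2)].
Proof.
have p0E : p (vec (1, 0, 0)) = vec (a, 0, 0) by rewrite p0 vecZ /= !mulr0 mulr1.
have p2E : p (vec (0, 0, 1)) = vec (0, 0, d) by rewrite p2 vecZ /= !mulr0 mulr1.
have ad : a * theta d = c.
  have := ph (vec (1, 0, 0)) (vec (0, 0, 1)).
  by rewrite p0E p2E !vec_form /= !(rmorph0, rmorph1, mulr0, mul0r, mulr1, addr0).
have [a0 d0] : a != 0 /\ d != 0.
  by split; apply: contra c_neq0 => /eqP e; rewrite -ad e ?rmorph0 ?mulr0 ?mul0r.
have [[[x b] z] p1] : exists t, p (vec (0, 1, 0)) = vec t.
  by exists (coords (p (vec (0, 1, 0)))); rewrite coordsK.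
have z0 : z = 0.
  have := ph (vec (0, 1, 0)) (vec (1, 0, 0)).
  rewrite p0E p1 !vec_form /= !(rmorph0, rmorph1, mulr0, mul0r, mulr1, addr0, add0r).
  by move/eqP; rewrite mulf_eq0 fmorph_eq0 (negPf a0) orbF => /eqP.
have x0 : x = 0.
  have := ph (vec (0, 1, 0)) (vec (0, 0, 1)).
  rewrite p2E p1 !vec_form /= !(rmorph0, rmorph1, mulr0, mul0r, mulr1, addr0, add0r).
  by move/eqP; rewrite mulf_eq0 fmorph_eq0 (negPf d0) orbF => /eqP.
have bb : b * theta b = c.
  have := ph (vec (0, 1, 0)) (vec (0, 1, 0)).
  rewrite p1 x0 z0 !vec_form /=.
  by rewrite !(rmorph0, rmorph1, mulr0, mul0r, mulr1, addr0, add0r).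
have b0 : b != 0 by apply: contra c_neq0 => /eqP e; rewrite -bb e mul0r.
exists b; split=> //.
  rewrite fmorph_div mulrACA -invfM ad bb divff //.
have p3 x1 x2 x3 u v w : p (x1 *: u + (x2 *: v + x3 *: w)) =
    sigma x1 *: p u + (sigma x2 *: p v + sigma x3 *: p w).
  by rewrite !(semilinearD pL) !(semilinearZ pL).
move=> [[t0 t1] t2] /=.
have -> : vec (t0, t1, t2) =
    t0 *: vec (1, 0, 0) + (t1 *: vec (0, 1, 0) + t2 *: vec (0, 0, 1)).
  by rewrite !vecZ !vecD /= !(mulr0, mulr1, addr0, add0r).
rewrite p3 p0E p2E p1 x0 z0 !vecZ !vecD /=.
rewrite !(mulr0, mulr1, addr0, add0r); congr (vec (_, _, _)).
- by rewrite mulrA mulrCA divff // mulr1 mulrC.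
- by rewrite mulrC.
by rewrite mulrA mulrCA divff // mulr1 mulrC.
Qed.

End TwoPointStabilizer.

Lemma map_d_iter n t : iter n map_d t =
  ((1 + i) ^+ n * t.1.1, t.1.2, (- (1 + i)) ^+ n * t.2).
Proof.
elim: n => [|n IHn]; first by case: t => [[x y] z]; rewrite /= !expr0 !mul1r.
by rewrite iterS IHn /map_d /= !exprS !mulrA.
Qed.

Lemma map_f_iter n t : iter n map_f t =
  (iter n theta t.1.1, iter n theta t.1.2, iter n theta t.2).
Proof.
by elim: n => [|n IHn]; [case: t => [[x y] z] | rewrite iterS IHn].
Qed.

Lemma coord_map_iter (p : {perm 'rV[K]_3}) g n t : p =1 vec \o g \o coords ->
  iter n p (vec t) = vec (iter n g t).
Proof.
by move=> pE; elim: n => //= n ->; rewrite pE /= vecK.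
Qed.

Lemma theta_iterM n : {morph iter n theta : x y / x * y}.
Proof. by elim: n => // n IHn x y; rewrite /= IHn rmorphM. Qed.

Lemma two_point_stabilizer (pd pf : {perm 'rV[K]_3}) (sd sf s : {perm pg_point K}) :
  pd \in GammaU h -> pf \in GammaU h ->
  pd =1 vec \o map_d \o coords -> pf =1 vec \o map_f \o coords ->
  induces pd sd -> induces pf sf -> s \in PGammaU h ->
  unital_perm s 0 = 0 -> unital_perm s 1 = 1 ->
  exists m j, [/\ (m < 8)%N, (j < 2)%N & s = (sd ^+ m * sf ^+ j)%g].
Proof.
move=> Gd Gf dE fE dsd fsf Gs s0 s1; have [q Gq qs] := PGammaUP Gs.
have fixed (k : 'I_28) : unital_perm s k = k ->
    exists a, q (unital_vec k) = a *: unital_vec k.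
  move=> sk; have := index_permE 0 unital_point_inj acts_unital_points k Gs.
  rewrite -/unital_perm sk => /(congr1 val)/=; rewrite /aperm => ek.
  apply/vlineP; rewrite ek.
  by rewrite (qs (unital_point k)) memv_line.
have u0E : unital_vec (0%R : 'I_28) = vec (1, 0, 0).
  by rewrite /unital_vec /gtoK /gauss_val /= !mul0r !addr0.
have u1E : unital_vec (1%R : 'I_28) = vec (0, 0, 1).
  by rewrite /unital_vec /gtoK /gauss_val /= !mul0r !addr0.
have [a qa] := fixed _ s0; have [d qd] := fixed _ s1; rewrite u0E u1E in qa qd.
have /asboolP[sigma [qL [c c0 qh]]] : `[< semisimilitude h q >] by rewrite inE in Gq.
have [b [b0 ab qE]] := diagonal_semisimilitude qL c0 qh qa qd.
have [j ltj sE] := endomorphism_cases sigma.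
have tjK x : iter j theta (iter j theta x) = x.
  by case: j ltj {sE} => [|[|]] //= _; rewrite thetaK.
have a0 : iter j theta (a / b) != 0.
  apply/eqP => e; have /eqP := tjK (a / b); rewrite e.
  have -> : iter j theta 0 = 0 by elim: (j) => //= m ->; rewrite rmorph0.
  rewrite eq_sym => /eqP e'; have /eqP := ab; rewrite e' mul0r eq_sym.
  by rewrite oner_eq0.
(* The product applies [pd ^+ n] first, so its coefficient must be the twist of a / b by [theta]^j.
   The third coefficient is then forced by [ab] and [zeta_unit], as [tdb] checks. *)
have [n ltn ezn] := zeta_power a0; exists n, j; split=> //.
have tdb : iter j theta ((- (1 + i)) ^+ n) = d / b.
  have e : (a / b) * theta (iter j theta ((- (1 + i)) ^+ n)) = 1.
    rewrite -[a / b]tjK -ezn -iterS iterSr -theta_iterM rmorphXn rmorphN /= -exprMn.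
    by rewrite mulrN zeta_unit expr1n; elim: (j) => //= m ->; rewrite rmorph1.
  apply: (fmorph_inj theta); apply: (@mulfI _ (a / b)); last by rewrite e ab.
  by apply/eqP=> e'; have /eqP := ab; rewrite e' mul0r eq_sym oner_eq0.
apply: (@induces_proportional q (pd ^+ n * pf ^+ j)%g _ _ b) => //.
- by rewrite groupM ?groupX.
- by apply: inducesM; apply: inducesX.
move=> v; rewrite -[v]coordsK qE permM !permX (coord_map_iter _ _ dE).
rewrite (coord_map_iter _ _ fE) map_d_iter map_f_iter /= !theta_iterM ezn tjK tdb.
by rewrite !sE.
Qed.

Lemma unital_perm_image :
  [/\ ('injm unital_perm)%g, [transitive^2 PGammaU h, on unital_points h | 'P]
    & exists d f t w : {perm 'I_28},
    [/\ realizes d tab_d, realizes f tab_f, realizes t tab_t, realizes w tab_w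
      & (unital_perm @* PGammaU h = <<[set d; f; t; w]>>)%g]].
Proof.
have gen g (c : gtriple -> gtriple) tab : semisimilitude h (vec \o g \o coords) ->
    (forall u, g (gtoK u) = gtoK (c u)) -> maps_by_table c tab -> all (gtn 28) tab ->
  exists p s, [/\ p \in GammaU h, p =1 vec \o g \o coords,
    s \in PGammaU h, induces p s & realizes (unital_perm s) tab].
  move=> sim gE ct t28; have [p Gp pE] := GammaU_of nondeg_h sim.
  have [s Gs ps] := PGammaU_of Gp; exists p, s; split=> //.
  exact: unital_perm_realizes pE gE _ ps ct t28.
have [pd [d [Gpd dE Gd dd rd]]] := gen _ _ _ map_d_sim gtoK_d table_d isT.
have [pf [f [Gpf fE Gf ff rf]]] := gen _ _ _ map_f_sim gtoK_f table_f isT.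
have [pt [t [_ _ Gt _ rt]]] := gen _ _ _ map_t_sim gtoK_t table_t isT.
have [pw [w [_ _ Gw _ rw]]] := gen _ _ _ map_w_sim gtoK_w table_w isT.
have [|injr imr tr1 tr2] := tables_image Gd Gf Gt Gw rd rf rt rw.
  by move=> s Gs s0 s1; apply: (two_point_stabilizer Gpd Gpf dE fE dd ff Gs s0 s1).
split=> //.
  rewrite unital_points_image.
  exact: (@doubly_transitive_index _ _ _ _ _ 0 1 _ unital_point_inj acts_unital_points).
by exists (unital_perm d), (unital_perm f), (unital_perm t), (unital_perm w).
Qed.

End UnitalCoordinates.

(** * Assembly of the equivalence *)

Local Open Scope ring_scope.

Lemma octonion_unital_equivalence (F4 : fieldExtType 'F_2)
    (dimF4 : (\dim {:F4} = 2)%N) (K : finFieldType) (theta : {rmorphism K -> K})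
    (char3 : 3%:R = 0 :> K) (thetaE : forall x, theta x = x ^+ 3)
    (thetaK : involutive theta) (theta_neq : exists x, theta x != x)
    (h : {hermitian 'rV[K]_3 for false & theta}) (nondeg_h : nondegenerate h) :
  [/\ oct_aut 'F_2 \isog PGammaU h,
      [transitive^2 PGammaU h, on unital_points h | 'P]
    & equivalent_actions 'P^* 'P
        (oct_aut_group 'F_2) (subalgebras_iso F4)
        (PGammaU_group h) (unital_points h)].
Proof.
have [i [i2 ti]] := sqrt_minus_one char3 thetaE thetaK theta_neq.
have [e0 [e1 [e2 hb]]] := hyperbolic_basis_ex char3 thetaE thetaK theta_neq nondeg_h.
have [injU trU [d [f [t [w [rd rf rt rw imU]]]]]] :=
  unital_perm_image char3 thetaE thetaK i2 ti nondeg_h hb.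
have [injO [d' [f' [t' [w' [rd' rf' rt' rw' imO]]]]]] := oct_perm_image.
(* A table determines its permutation, so the two images have the same four generators. *)
rewrite (realizes_inj rd' rd) (realizes_inj rf' rf) in imO.
rewrite (realizes_inj rt' rt) (realizes_inj rw' rw) -imU in imO.
have equiv : equivalent_actions 'P^* 'P (oct_aut_group 'F_2) (subalgebras_iso F4)
    (PGammaU_group h) (unital_points h).
  rewrite (subalgebras_iso_F4 dimF4).
  rewrite (unital_points_image char3 thetaE thetaK i2 ti hb).
  exact: equivalent_actions_common_image injO injU imO.
split=> //; have [_ _ [g [_ [isog _ _ _]]]] := equiv.
exact: isom_isog isog.
Qed.

(** * The Galois group of the field of nine elements *)

Section NineElementExtension.
Local Open Scope ring_scope.
Variables (F9 : fieldExtType 'F_3).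
Hypothesis dimF9 : (\dim {:F9} = 2)%N.
Variable theta : gal_of {:finvect_type F9}.
Hypothesis gen_theta : generator 'Gal({:finvect_type F9} / 1) theta.

Lemma F9_char3 : 3%:R = 0 :> finvect_type F9.
Proof.
have -> : 3%:R = (3%:R : 'F_3) *: (1 : finvect_type F9) by rewrite scaler_nat.
by rewrite (_ : 3%:R = 0 :> 'F_3) ?scale0r //; apply: val_inj.
Qed.

Lemma F9_galois_order : (#[theta] = 2)%g.
Proof.
have := galois_dim (finField_galois (sub1v {:finvect_type F9}%AS)).
rewrite dimv1 divn1 (eqP gen_theta) orderE => <-; exact: dimF9.
Qed.

(** The Galois group has order 2 and the Frobenius map generates it, so [theta] is its only
    nontrivial element. *)
Lemma F9_theta_exp x : theta x = x ^+ 3.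
Proof.
have [alpha ga aE] := finField_galois_generator (sub1v {:finvect_type F9}%AS).
have ord := F9_galois_order.
have : alpha \in 'Gal({:finvect_type F9} / 1)%g by rewrite (eqP ga) cycle_id.
rewrite (eqP gen_theta) (cycle2g ord) !inE => /orP[/eqP a1|/eqP <-].
  have : #[theta]%g = 1%N.
    by rewrite orderE -(eqP gen_theta) (eqP ga) a1 -orderE order1.
  by rewrite ord.
by rewrite aE ?memvf // dimv1 expn1 card_Fp.
Qed.

Lemma F9_thetaK : involutive theta.
Proof.
move=> x; have tt : (theta * theta = 1)%g.
  by have := expg_order theta; rewrite F9_galois_order.
by rewrite -galM ?memvf // tt gal_id.
Qed.

Lemma F9_theta_neq : exists x, theta x != x.
Proof.
apply/existsP; apply: contraPT F9_galois_order.
rewrite negb_exists => /forallP tid; suff -> : theta = 1%g by rewrite order1.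
apply/eqP/gal_eqP => x _; rewrite gal_id; apply/eqP.
by have := tid x; rewrite negbK.
Qed.

End NineElementExtension.

Local Open Scope ring_scope.

Theorem theorem7p1
    (F4 : fieldExtType 'F_2) (dimF4 : (\dim {:F4} = 2)%N)
    (F9 : fieldExtType 'F_3) (dimF9 : (\dim {:F9} = 2)%N)
    (theta : gal_of {:finvect_type F9})
    (gen_theta : generator 'Gal({:finvect_type F9} / 1) theta)
    (h : {hermitian 'rV[finvect_type F9]_3 for false & theta})
    (nondeg_h : nondegenerate h) :
  [/\ oct_aut 'F_2 \isog PGammaU h,
      [transitive^2 PGammaU h, on unital_points h | 'P]
    & equivalent_actions 'P^* 'P
        (oct_aut_group 'F_2) (subalgebras_iso F4)
        (PGammaU_group h) (unital_points h)].
Proof.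
exact: (octonion_unital_equivalence dimF4 (F9_char3 F9)
  (F9_theta_exp dimF9 gen_theta) (F9_thetaK dimF9 gen_theta)
  (F9_theta_neq dimF9 gen_theta) nondeg_h).
Qed.
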